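(* Let $\Omega=\{z\in\mathbb{C}: |z|<1,\ \operatorname{Im} z>0\}$ be the upper half-disk, and let $$\partial_1\Omega=\{\operatorname{Re} z\in(-1,0),\ \operatorname{Im} z=0\}\cup\{|z|=1,\ |\arg z-\pi/2|<\pi/4\},$$ $$\partial_2\Omega=\{\operatorname{Re} z\in(0,1),\ \operatorname{Im} z=0\}\cup\{|z|=1,\ \pi/4<|\arg z-\pi/2|<\pi/2\}.$$ Let $\sigma_{\mathrm{I}}$ be the spectrum of the boundary value problem (Problem I) $$-\Delta u=\lambda u\ \text{ in }\Omega,\qquad u|_{\partial_1\Omega}=0,\qquad \left.\frac{\partial u}{\partial n}\right|_{\partial_2\Omega}=0,$$ and let $\sigma_{\mathrm{II}}$ be the spectrum of the boundary value problem (Problem II) $$-\Delta v=\lambda v\ \text{ in }\Omega,\qquad v|_{\partial_2\Omega}=0,\qquad \left.\frac{\partial v}{\partial n}\right|_{\partial_1\Omega}=0.$$ Then $\sigma_{\mathrm{I}}=\sigma_{\mathrm{II}}$, with account of multiplicities.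
   Context: The plane $\mathbb{R}^2$ is identified with $\mathbb{C}$ via $z=x+\mathrm{i}y$. $\Delta=\partial^2/\partial x^2+\partial^2/\partial y^2$ is the Laplace operator and $\partial/\partial n$ is the normal derivative on the boundary. The spectra are those of the Laplacian (the operator $-\Delta$) with mixed Dirichlet-Neumann boundary conditions, in the usual variational (weak) sense; both are discrete and positive. *)

(* Defs.v *)
From HB Require Import structures.
From mathcomp Require Import all_boot all_order all_algebra.
From mathcomp Require Import all_classical all_reals all_analysis.

Set Implicit Arguments.
Unset Strict Implicit.
Unset Printing Implicit Defensive.

Import Order.TTheory GRing.Theory Num.Theory.
Import numFieldNormedType.Exports.

Local Open Scope classical_set_scope.
Local Open Scope ring_scope.

(* The point (x, y) of [R * R] stands for the complex number x + iy. *)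

Definition half_disk (R : realType) : set (R * R) :=
  [set z | z.1 ^+ 2 + z.2 ^+ 2 < 1 /\ 0 < z.2].

(* On the upper unit half-circle, [t] is the principal argument of
   (cos t, sin t). *)
Definition boundary1 (R : realType) : set (R * R) :=
  [set z | -1 < z.1 < 0 /\ z.2 = 0] `|`
  [set (cos t, sin t) | t in [set t : R | `|t - pi / 2| < pi / 4]].

Definition boundary2 (R : realType) : set (R * R) :=
  [set z | 0 < z.1 < 1 /\ z.2 = 0] `|`
  [set (cos t, sin t) | t in [set t : R | pi / 4 < `|t - pi / 2| < pi / 2]].

Definition area (R : realType) :
    {measure set (measurableTypeR R * measurableTypeR R) -> \bar R} :=
  (@lebesgue_measure R \x @lebesgue_measure R)%E.

Definition grad (R : realType) (f : R * R -> R) (z : R * R) : R * R :=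
  ('D_((1 : R), (0 : R)) f z, 'D_((0 : R), (1 : R)) f z).

Definition dot (R : realType) (a b : R * R) : R := a.1 * b.1 + a.2 * b.2.

Definition C1_on (R : realType) (U : set (R * R)) (f : R * R -> R) : Prop :=
  forall z, U z -> differentiable f z /\ {for z, continuous (grad f)}.

Definition C1_closure (R : realType) (D : set (R * R)) (f : R * R -> R) : Prop :=
  exists U : set (R * R), [/\ open U, closure D `<=` U & C1_on U f].

Definition test_function (R : realType) (D : set (R * R))
    (f : R * R -> R) : Prop :=
  C1_on setT f /\
  exists K : set (R * R),
    [/\ compact K, K `<=` D & forall z, ~ K z -> f z = 0].

Definition L2 (R : realType) (D : set (R * R)) (u : R * R -> R) : Prop :=
  @measurable_fun _ _ (measurableTypeR R * measurableTypeR R)%type R D u /\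
  (@area R).-integrable D (fun z => ((u z) ^+ 2)%:E).

Definition weak_gradient (R : realType) (D : set (R * R))
    (u : R * R -> R) (g : R * R -> R * R) : Prop :=
  forall f, test_function D f ->
    (\int[@area R]_(z in D) (u z * (grad f z).1)
      = - (\int[@area R]_(z in D) ((g z).1 * f z)))%R /\
    (\int[@area R]_(z in D) (u z * (grad f z).2)
      = - (\int[@area R]_(z in D) ((g z).2 * f z)))%R.

(* [u] belongs to the Sobolev space H^1(D) and has weak gradient [g]; as a
   weak gradient is unique almost everywhere, [g] only selects a
   representative. *)
Definition H1 (R : realType) (D : set (R * R))
    (u : R * R -> R) (g : R * R -> R * R) : Prop :=
  [/\ L2 D u, L2 D (fun z => (g z).1), L2 D (fun z => (g z).2)
    & weak_gradient D u g].

(* The form domain of the problem with Dirichlet condition on [G]: the closure,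
   in the norm of H^1(D), of the functions of class C^1 up to the boundary
   which vanish on [G]. The integral below is the square of the H^1 distance
   from [u] to [f]. *)
Definition H1_0 (R : realType) (D G : set (R * R))
    (u : R * R -> R) (g : R * R -> R * R) : Prop :=
  H1 D u g /\
  forall e : R, 0 < e ->
    exists f : R * R -> R,
      [/\ C1_closure D f, (forall z, G z -> f z = 0)
        & (\int[@area R]_(z in D)
             ((u z - f z) ^+ 2
              + dot (g z - grad f z) (g z - grad f z))%:E < e%:E)%E].

(* [u] is a weak solution of
     - Laplacian u - l u = f in D,  u = 0 on G,  du/dn = 0 on the rest of the
   boundary. The Neumann condition is the natural boundary condition: it is
   carried by the test functions [w] not being restricted off [G]. *)
Definition weak_solution (R : realType) (D G : set (R * R)) (l : R)
    (f u : R * R -> R) : Prop :=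
  exists g, H1_0 D G u g /\
    forall w h, H1_0 D G w h ->
      \int[@area R]_(z in D) dot (g z) (h z)
        - l * \int[@area R]_(z in D) (u z * w z)
      = \int[@area R]_(z in D) (f z * w z).

Definition ae_equal (R : realType) (D : set (R * R)) (u v : R * R -> R) : Prop :=
  {ae @area R, forall z, D z -> u z = v z}.

(* The spectrum of the operator on L^2(D) associated with the form, that is,
   the complement of its resolvent set. Since this operator is closed,
   [l] is in the resolvent set if and only if the operator minus [l] is
   bijective from its domain onto L^2(D); and since it is self-adjoint, only
   real [l] matter. *)
Definition spectrum (R : realType) (D G : set (R * R)) : set R :=
  [set l | ~ forall f, L2 D f ->
     exists u, weak_solution D G l f u /\
       forall v, weak_solution D G l f v -> ae_equal D u v].

Definition weak_eigenspace (R : realType) (D G : set (R * R)) (l : R) :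
    set (R * R -> R) :=
  [set u | weak_solution D G l (cst 0) u].

(* The dimension of the eigenspace in L^2(D), where functions equal almost
   everywhere on D are identified. It is 0 if [l] is not an eigenvalue. *)
Definition multiplicity (R : realType) (D G : set (R * R)) (l : R) : \bar R :=
  ereal_sup [set n%:R%:E | n in [set n : nat |
    exists u : 'I_n -> (R * R -> R),
      (forall i, weak_eigenspace D G l (u i)) /\
      forall c : 'I_n -> R,
        ae_equal D (fun z => \sum_(i < n) c i * u i z) (cst 0) ->
        forall i, c i = 0]].

(* Main.v *)
(* In Problem I a function u(r, theta) extends to all theta by reflection, evenly
   about the Neumann ray theta = 0 and oddly about the Dirichlet ray theta = pi.
   The conditions on the arc then become pi-periodic with pattern N D D N on
   sectors of angle pi/4, so a rotation by pi/2 turns them into D N N D.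
   Accordingly
     v(theta) = u(theta + pi/2) - u(theta - pi/2)
   is odd about theta = 0, even about theta = pi, and carries the arc
   conditions of Problem II.  Up to the factor 1/sqrt 2 the map u |-> v is
   unitary on L^2 and for the Dirichlet form, and the transplantation in the
   opposite direction is its inverse.  It thus maps weak solutions to weak
   solutions.

   The analytic difficulty is that v is in general only Lipschitz across the
   axis x = 0, even if u is smooth up to the boundary, so that it is not
   obviously a limit of C^1 functions satisfying the Dirichlet condition.  Such
   approximations come from precomposing u with a map that preserves |z| and is
   the identity outside of a strip |x| < 2e, where it flattens u in the normal
   direction of the cut, and from cutting off near the origin, where u
   vanishes. *)

From HB Require Import structures.
Require Import Defs.
From mathcomp Require Import all_boot all_order all_algebra.
From mathcomp Require Import all_classical all_reals all_analysis.
From mathcomp Require Import measurable_realfun ring lra.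

Set Implicit Arguments.
Unset Strict Implicit.
Unset Printing Implicit Defensive.

Import Order.TTheory GRing.Theory Num.Theory.
Import numFieldNormedType.Exports.

Local Open Scope classical_set_scope.
Local Open Scope ring_scope.

(** On the quarter-disk x > 0 a function is the pair of itself and its mirror image, and
    transplantation is the exchange of x and y followed by a constant 2 x 2 matrix, orthogonal after
    the scaling by 1/sqrt 2. The partial derivatives are exchanged likewise, each with its own
    orthogonal matrix, and the transposes belong to the opposite transplantation. Isometry,
    adjointness and inversion are thus matrix identities; only the form domain needs analysis.

    There the flattening removes the jump of the normal derivative across the cut, but the flattened
    function may violate the Dirichlet condition on the real axis at distance O(e) from the origin,
    which the cutoff repairs. The gradient of the cutoff, of order 1/e, meets values of order e,
    since the smooth u is differentiable and 0 at the origin. So the approximant has a gradient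
    bounded uniformly in e and differs from the transplant only on a strip of area O(e): the H^1
    error tends to 0. From II to I one subtlety remains: near the point i of the arc the flattening
    leads to the corners of the half-disk. *)

Notation plane R := (measurableTypeR R * measurableTypeR R)%type.


(** * Change of variables under measure-preserving maps *)

Section transport.
Context d (T : measurableType d) (R : realType) (mu : {measure set T -> \bar R}).

Definition measure_preserving (phi : T -> T) :=
  measurable_fun setT phi /\
  forall A, measurable A -> mu (phi @^-1` A) = mu A.

Variables (phi : T -> T) (P : measure_preserving phi) (D : set T).
Hypothesis mD : measurable D.

Lemma measurable_preimage_preserving : measurable (phi @^-1` D).
Proof. by case: P => mphi _; rewrite -[X in measurable X]setTI; exact: mphi. Qed.

Lemma measurable_fun_preserving d' (T' : measurableType d') (f : T -> T') :
  measurable_fun D f -> measurable_fun (phi @^-1` D) (f \o phi).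
Proof.
move=> mf; case: P => mphi _.
apply: (measurable_comp (F := D)) => //; first by move=> _ [z /= Dz <-].
exact: measurable_funTS.
Qed.

Lemma ge0_integral_preserving (f : T -> \bar R) :
  measurable_fun D f -> (forall z, D z -> 0 <= f z)%E ->
  (\int[mu]_(z in phi @^-1` D) f (phi z) = \int[mu]_(z in D) f z)%E.
Proof.
move=> mf f0; case: (P) => mphi Phi.
rewrite -[LHS](ge0_integral_pushforward mphi) //; last by move=> y /[!inE]; exact: f0.
by apply: eq_measure_integral => A mA AD; exact: Phi.
Qed.

Lemma integral_preserving (f : T -> \bar R) :
  measurable_fun D f ->
  (\int[mu]_(z in phi @^-1` D) f (phi z) = \int[mu]_(z in D) f z)%E.
Proof.
move=> mf; rewrite integralE [RHS]integralE.
rewrite -(ge0_integral_preserving (f := (f^\+)%E)) //; last exact: measurable_funepos.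
rewrite -(ge0_integral_preserving (f := (f^\-)%E)) //; last exact: measurable_funeneg.
by congr (_ - _)%E; apply: eq_integral => z _; rewrite ?funeposE ?funenegE.
Qed.

Lemma Rintegral_preserving (f : T -> R) :
  measurable_fun D f ->
  (\int[mu]_(z in phi @^-1` D) f (phi z) = \int[mu]_(z in D) f z)%R.
Proof.
move=> mf; rewrite /Rintegral -(integral_preserving (f := EFin \o f)) //.
exact/measurable_EFinP.
Qed.

Lemma integrable_preserving (f : T -> \bar R) :
  mu.-integrable D f -> mu.-integrable (phi @^-1` D) (f \o phi).
Proof.
move=> /integrableP[mf fi]; apply/integrableP; split.
  exact: measurable_fun_preserving.
rewrite (ge0_integral_preserving (f := abse \o f)) //.
  exact: measurableT_comp.
by move=> z _; exact: abse_ge0.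
Qed.

End transport.

(** * Reflections of the plane and folding of the half-disk *)

Section plane_measure.
Context {R : realType}.
Implicit Types (A B : set (R * R)) (f g h : R * R -> R).

Definition mirror (z : R * R) : R * R := (- z.1, z.2).
Definition transp (z : R * R) : R * R := (z.2, z.1).

Lemma measurable_mirror : @measurable_fun _ _ (plane R) (plane R) setT mirror.
Proof.
apply: measurable_fun_pair => /=; last exact: measurable_snd.
exact: (@measurableT_comp _ _ _ _ _ _ (@GRing.opp R) _ _ _ measurable_fst).
Qed.

Lemma measurable_transp : @measurable_fun _ _ (plane R) (plane R) setT transp.
Proof.
apply: measurable_fun_pair; [exact: measurable_snd | exact: measurable_fst].
Qed.

(** Lebesgue measure is determined by its values on half-open intervals; negation moves the closed
    end to the other side and keeps the length. *)
Lemma lebesgue_measure_opp (A : set (measurableTypeR R)) : measurable A ->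
  lebesgue_measure ((@GRing.opp R) @^-1` A) = lebesgue_measure A.
Proof.
move=> mA.
have mo : @measurable_fun _ _ (measurableTypeR R) (measurableTypeR R) setT (@GRing.opp R) by [].
rewrite -[LHS]/(pushforward (@lebesgue_measure R) (@GRing.opp R) A).
have H := @lebesgue_measure_unique R (measure_function_pushforward__canonical__measure_function_Measure lebesgue_measure mo).
apply/esym/H => //= X [[a b] /= _ <-].
rewrite /pushforward.
have -> : (@GRing.opp R) @^-1` `]a, b] = `[- b, - a[%classic.
  by apply/seteqP; split=> x /=; rewrite !in_itv/= lerNl ltrNr andbC.
rewrite !lebesgue_measure_itv /= !lte_fin ltrN2 -!EFinB opprK addrC.
by [].
Qed.

Lemma area_rect (X Y : set (measurableTypeR R)) : measurable X -> measurable Y ->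
  area R (X `*` Y) = (lebesgue_measure X * lebesgue_measure Y)%E.
Proof. by move=> mX mY; rewrite -[LHS]/((lebesgue_measure \x lebesgue_measure)%E (X `*` Y)) product_measure1E. Qed.

(** A product measure is determined by its values on rectangles, where the reflection acts on one
    factor only. *)
Lemma area_mirror (A : set (plane R)) : measurable A -> area R (mirror @^-1` A) = area R A.
Proof.
move=> mA; have := measurable_mirror => mo.
pose m' := measure_function_pushforward__canonical__measure_function_Measure (area R) mo.
apply/esym; apply: (@product_measure_unique _ _ _ _ _ _ _ m') => // X Y mX mY.
rewrite /= /pushforward.
have mop : @measurable_fun _ _ (measurableTypeR R) (measurableTypeR R) setT (@GRing.opp R) by [].
have -> : mirror @^-1` (X `*` Y) = ((@GRing.opp R) @^-1` X) `*` Y by [].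
rewrite area_rect // ?lebesgue_measure_opp //.
by rewrite -[X in measurable X]setTI; exact: mop.
Qed.

Lemma area_transp (A : set (plane R)) : measurable A -> area R (transp @^-1` A) = area R A.
Proof.
move=> mA; have := measurable_transp => mo.
pose m' := measure_function_pushforward__canonical__measure_function_Measure (area R) mo.
apply/esym; apply: (@product_measure_unique _ _ _ _ _ _ _ m') => // X Y mX mY.
rewrite /= /pushforward.
have -> : transp @^-1` (X `*` Y) = Y `*` X by apply/seteqP; split => z [].
by rewrite area_rect // muleC.
Qed.

Lemma measure_preserving_mirror : measure_preserving (area R) mirror.
Proof. by split; [exact: measurable_mirror | exact: area_mirror]. Qed.

Lemma measure_preserving_transp : measure_preserving (area R) transp.
Proof. by split; [exact: measurable_transp | exact: area_transp]. Qed.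


(** The sigma-algebra of [plane R] is the product one, so openness has to be used through a
    countable union: [U] is the union of the squares with rational centre and half-width that it
    contains. *)
Lemma open_measurable_plane (U : set (R * R)) :
  open U -> measurable (U : set (plane R)).
Proof.
move=> oU.
pose sq (r p q : rat) : set (plane R) :=
  `]ratr p - ratr r, ratr p + ratr r[%classic `*`
  `]ratr q - ratr r, ratr q + ratr r[%classic.
have -> : U = \bigcup_r \bigcup_p \bigcup_q
    (if `[< sq r p q `<=` U >] then sq r p q else set0).
  apply/seteqP; split => [[x y] Uxy | z [r _ [p _ [q _]]]]; last first.
    by case: asboolP => // H /H.
  have /nbhs_ballP[e /= e0 eU] := open_nbhs_nbhs (conj oU Uxy).
  have [r /[!in_itv]/= /andP[r0 re]] : exists r : rat, (ratr r : R) \in `]0, e / 2[.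
    by apply: rat_in_itvoo; rewrite divr_gt0.
  have near_rat (t : R) : exists p : rat, `|t - ratr p| < ratr r.
    have [p /[!in_itv]/= /andP[p1 p2]] : exists p : rat, (ratr p : R) \in `]t - ratr r, t + ratr r[.
      by apply: rat_in_itvoo; lra.
    by exists p; rewrite ltr_norml; lra.
  have [p] := near_rat x; rewrite ltr_norml => /andP[p1 p2].
  have [q] := near_rat y; rewrite ltr_norml => /andP[q1 q2].
  exists r => //; exists p => //; exists q => //.
  case: asboolP => [_|[]]; first by split; rewrite /= in_itv /=; lra.
  move=> [a b] [] /=; rewrite !in_itv/= => /andP[a1 a2] /andP[b1 b2].
  by apply: eU; split => /=; rewrite /ball /= ltr_norml; lra.
apply: bigcupT_measurable_rat => r; apply: bigcupT_measurable_rat => p.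
apply: bigcupT_measurable_rat => q; case: ifPn => // _.
by apply: measurableX; exact: measurable_itv.
Qed.

Lemma continuous_measurable_plane (U : set (R * R)) (f : R * R -> R) :
  open U -> (forall z, U z -> {for z, continuous f}) ->
  @measurable_fun _ _ (plane R) R U f.
Proof.
move=> oU cf; apply: (measurability _ (RGenOpens.measurableE R)).
move=> _ [_ [a [b ->] <-]]; apply: open_measurable_plane.
rewrite openE => z [Uz fz]; apply: filterI; first exact: open_nbhs_nbhs.
by apply: cf => //; apply: open_nbhs_nbhs; split => //; exact: interval_open.
Qed.

Lemma continuous_fst_plane : continuous (fun z : R * R => z.1).
Proof. by move=> z; exact: cvg_fst. Qed.

Lemma continuous_snd_plane : continuous (fun z : R * R => z.2).
Proof. by move=> z; exact: cvg_snd. Qed.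

(** [mirror] carries this set to the left half of the half-disk, and [transp] carries it to itself;
    all computations are folded onto it. *)
Definition quarter_disk : set (R * R) := [set z | half_disk z /\ 0 < z.1].

Lemma open_half_disk : open (@half_disk R).
Proof.
have -> : @half_disk R =
    (fun z => z.1 ^+ 2 + z.2 ^+ 2) @^-1` [set t | t < 1] `&`
    (fun z => z.2) @^-1` [set t | 0 < t] by [].
apply: openI; apply: open_comp; try exact: open_lt; try exact: open_gt.
  move=> z _; apply: cvgD; rewrite !expr2; apply: cvgM;
    (exact: continuous_fst_plane || exact: continuous_snd_plane).
by move=> z _; exact: continuous_snd_plane.
Qed.

Lemma open_quarter_disk : open quarter_disk.
Proof.
have -> : quarter_disk = @half_disk R `&` (fun z => z.1) @^-1` [set t | 0 < t] by [].
apply: openI; first exact: open_half_disk.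
by apply: open_comp; [move=> z _; exact: continuous_fst_plane | exact: open_gt].
Qed.

Lemma measurable_half_disk : measurable (@half_disk R : set (plane R)).
Proof. exact: (open_measurable_plane open_half_disk). Qed.

Lemma measurable_quarter_disk : measurable (quarter_disk : set (plane R)).
Proof. exact: (open_measurable_plane open_quarter_disk). Qed.

Lemma quarter_disk_sub : quarter_disk `<=` @half_disk R.
Proof. by move=> z []. Qed.

Lemma half_disk_mirror z : @half_disk R (mirror z) = half_disk z.
Proof. by rewrite /half_disk /mirror /= sqrrN. Qed.

Lemma quarter_disk_transp : transp @^-1` quarter_disk = quarter_disk.
Proof.
by apply/seteqP; split => -[x y] [[/= h1 h2] h3]; split => //; split => //=;
  rewrite addrC.
Qed.

Definition axis : set (R * R) := [set z | z.1 = 0].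

Lemma area_axis : area R (axis : set (plane R)) = 0%E.
Proof.
have -> : axis = [set 0] `*` setT by apply/seteqP; split => z //= [].
by rewrite area_rect // lebesgue_measure_set1 mul0e.
Qed.

Lemma measurable_axis : measurable (axis : set (plane R)).
Proof.
have -> : axis = [set 0] `*` setT by apply/seteqP; split => z //= [].
exact: measurableX.
Qed.

Lemma half_diskE : @half_disk R `\` axis =
  quarter_disk `|` mirror @^-1` quarter_disk.
Proof.
apply/seteqP; split => [z [Dz /= z0]|z [[Dz z0]|[Dz /= z0]]].
- rewrite /axis /= in z0.
  have [z1|z1|//] := ltgtP z.1 0; [right|by left].
  by split; rewrite ?half_disk_mirror//= oppr_gt0.
- by split => // zz; move: z0; rewrite zz ltxx.
- rewrite half_disk_mirror in Dz; split => // zz.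
  by move: z0; rewrite zz oppr0 ltxx.
Qed.

Local Notation Q := quarter_disk.
Local Notation D := (@half_disk R).
Local Notation mu := (area R).

Lemma integrable_fold (f : R * R -> \bar R) : mu.-integrable D f ->
  mu.-integrable Q f /\ mu.-integrable Q (f \o mirror).
Proof.
have mD := measurable_half_disk; have mQ := measurable_quarter_disk.
move=> fi; split; first exact: (integrableS mD mQ quarter_disk_sub fi).
apply: (integrableS mD mQ quarter_disk_sub).
have := integrable_preserving measure_preserving_mirror mD fi.
by congr (mu.-integrable _ _); apply/funext => z; rewrite /= half_disk_mirror.
Qed.

Lemma Rintegral_fold (f : R * R -> R) : mu.-integrable D (EFin \o f) ->
  (\int[mu]_(z in D) f z =
   \int[mu]_(z in Q) f z + \int[mu]_(z in Q) f (mirror z))%R.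
Proof.
have mD := measurable_half_disk; have mQ := measurable_quarter_disk.
have mA := measurable_axis => fi.
have mQ' := measurable_preimage_preserving measure_preserving_mirror mQ.
have [fQ fQ'] := integrable_fold fi.
have fD : mu.-integrable (Q `|` mirror @^-1` Q) (EFin \o f).
  by rewrite -half_diskE; apply: (integrableS mD _ _ fi);
    [exact: measurableD | exact: subDsetl].
rewrite /Rintegral (negligible_integral mA mD fi area_axis) half_diskE.
rewrite -[LHS]/(\int[mu]_(x in Q `|` mirror @^-1` Q) f x)%R Rintegral_setU //; last first.
  by apply/disj_setPS => z [[_ z1] [_ /= z2]]; lra.
congr (_ + _); rewrite -(Rintegral_preserving measure_preserving_mirror).
- by congr Rintegral; apply/funext => z; rewrite /= /mirror /= opprK; case: z.
- exact: mQ'.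
- apply/measurable_EFinP; apply: measurable_int.
  by apply: (integrableS _ _ _ fD) => //; [exact: measurableU].
Qed.

Lemma Rintegral_transp (f : R * R -> R) : @measurable_fun _ _ (plane R) R Q f ->
  (\int[mu]_(z in Q) f (transp z) = \int[mu]_(z in Q) f z)%R.
Proof.
move=> mf; rewrite -[RHS](Rintegral_preserving measure_preserving_transp) //.
  by rewrite quarter_disk_transp.
exact: measurable_quarter_disk.
Qed.

(** The product sigma-algebra is not complete, so measurability on the axis does not follow from its
    being a null set; it comes from the constant value there. *)
Lemma measurable_fun_fold (f : R * R -> R) :
  @measurable_fun _ _ (plane R) R Q f ->
  @measurable_fun _ _ (plane R) R Q (f \o mirror) ->
  (forall z, axis z -> f z = 0) ->
  @measurable_fun _ _ (plane R) R D f.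
Proof.
have mD := measurable_half_disk; have mQ := measurable_quarter_disk.
have mA := measurable_axis => mf mfm f0.
have mQ' := measurable_preimage_preserving measure_preserving_mirror mQ.
have -> : D = (Q `|` mirror @^-1` Q) `|` (D `&` axis).
  by rewrite -half_diskE setUC setUIDK.
apply/measurable_funU; [exact: measurableU | exact: measurableI |].
split.
  apply/measurable_funU => //; split => //.
  have := measurable_fun_preserving measure_preserving_mirror mQ mfm.
  by congr measurable_fun; apply/funext => z; rewrite /= /mirror /= opprK; case: z.
apply: (eq_measurable_fun (cst (0 : R) : plane R -> R)); last exact: measurable_cst.
by move=> z; rewrite inE => -[_ /f0].
Qed.

Lemma integrable_unfold (f : R * R -> R) :
  @measurable_fun _ _ (plane R) R D f ->
  mu.-integrable Q (EFin \o f) -> mu.-integrable Q (EFin \o f \o mirror) ->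
  mu.-integrable D (EFin \o f).
Proof.
have mD := measurable_half_disk; have mQ := measurable_quarter_disk.
have mA := measurable_axis => mf fQ fQm.
have mQ' := measurable_preimage_preserving measure_preserving_mirror mQ.
apply/(negligible_integrable mA mD) => //; first exact/measurable_EFinP.
  exact: area_axis.
rewrite half_diskE.
have fQ' : mu.-integrable (mirror @^-1` Q) (EFin \o f).
  have := integrable_preserving measure_preserving_mirror mQ fQm.
  by congr (mu.-integrable _ _); apply/funext => z; rewrite /= /mirror /= opprK; case: z.
have sub : Q `|` mirror @^-1` Q `<=` D by rewrite -half_diskE; exact: subDsetl.
have mf' : @measurable_fun _ _ (plane R) _ (Q `|` mirror @^-1` Q) (EFin \o f).
  by apply/measurable_EFinP; exact: (measurable_funS mD sub mf).
apply/integrableP; split => //.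
have mn : @measurable_fun _ _ (plane R) _ (Q `|` mirror @^-1` Q) (abse \o (EFin \o f)).
  exact: measurableT_comp.
rewrite ge0_integral_setU //; last first.
  by apply/disj_setPS => z [[_ z1] [_ /= z2]]; lra.
have /integrableP[_ ?] := fQ; have /integrableP[_ ?] := fQ'.
exact: lte_add_pinfty.
Qed.

End plane_measure.

(** * Square integrable functions *)

Section square_integrable.
Context d (T : measurableType d) (R : realType) (mu : {measure set T -> \bar R}).
Variables (D : set T) (mD : measurable D).

(** [L2] over an arbitrary measure space; for [area R] the two are convertible, and the lemmas below
    are applied to [L2] directly. *)
Definition sqint (f : T -> R) :=
  measurable_fun D f /\ mu.-integrable D (fun z => ((f z) ^+ 2)%:E).

Lemma sqintM (f g : T -> R) : sqint f -> sqint g ->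
  mu.-integrable D (EFin \o (fun z => f z * g z)).
Proof.
move=> [mf fi] [mg gi].
apply: (le_integrable mD _ _ (integrableD mD fi gi)).
  by apply/measurable_EFinP; exact: measurable_funM.
move=> z _ /=; rewrite lee_fin.
rewrite (ger0_norm (addr_ge0 (sqr_ge0 _) (sqr_ge0 _))).
have := sqr_ge0 (f z + g z); have := sqr_ge0 (f z - g z).
by rewrite ler_norml !expr2 => ? ?; nra.
Qed.

Lemma sqintD (f g : T -> R) : sqint f -> sqint g -> sqint (fun z => f z + g z).
Proof.
move=> Sf Sg; have fg := sqintM Sf Sg; case: Sf Sg => mf fi [mg gi].
split; first exact: measurable_funD.
have := integrableD mD (integrableD mD fi gi) (integrableZl mD 2 fg).
apply: eq_integrable => // z _ /=; rewrite -EFinM -!EFinD; congr EFin.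
by ring.
Qed.

Lemma sqintZ (c : R) (f : T -> R) : sqint f -> sqint (fun z => c * f z).
Proof.
move=> [mf fi]; split; first exact: measurable_funM.
have := integrableZl mD (c ^+ 2) fi.
by apply: eq_integrable => // z _ /=; rewrite -EFinM exprMn.
Qed.

Lemma sqintB (f g : T -> R) : sqint f -> sqint g -> sqint (fun z => f z - g z).
Proof.
move=> Sf Sg; have := sqintD Sf (sqintZ (-1) Sg).
by congr sqint; apply/funext => z; rewrite mulN1r.
Qed.

Lemma sqint0 : sqint (fun _ => 0).
Proof.
split; first exact: measurable_cst.
rewrite expr0n /=; exact: integrable0.
Qed.

Lemma eq_sqint (u v : T -> R) : (forall z, D z -> u z = v z) ->
  sqint u -> sqint v.
Proof.
move=> uv [mu' ui]; split.
  by apply: eq_measurable_fun mu' => // z; rewrite inE; exact: uv.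
by apply: eq_integrable ui => // z; rewrite inE => /uv ->.
Qed.

Lemma sqint_bounded (f : T -> R) (M : R) : (mu D < +oo)%E ->
  measurable_fun D f -> (forall z, D z -> `|f z| <= M) -> sqint f.
Proof.
move=> Doo mf fM; split => //.
apply: (measurable_bounded_integrable _ Doo) => //.
  exact: measurable_funX.
exists (M ^+ 2); split; first exact: num_real.
move=> N MN z Dz /=.
rewrite normrX (le_trans _ (ltW MN)) // lerXn2r ?nnegrE //.
- by rewrite (le_trans _ (fM z Dz)).
- exact: fM.
Qed.

Lemma sqint_ae0 (f : T -> R) : sqint f -> \int[mu]_(z in D) (f z * f z) = 0 ->
  {ae mu, forall z, D z -> f z = 0}.
Proof.
move=> [mf fi] f0.
have f0' : (\int[mu]_(z in D) ((f z) ^+ 2)%:E = 0)%E.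
  have <- : (fine (\int[mu]_(z in D) ((f z) ^+ 2)%:E))%:E =
      (\int[mu]_(z in D) ((f z) ^+ 2)%:E)%E.
    by rewrite fineK //; exact: integrable_fin_num.
  by congr EFin; rewrite -f0; apply: eq_Rintegral => z _; rewrite expr2.
have mf2 : measurable_fun D (fun z => ((f z) ^+ 2)%:E).
  by apply/measurable_EFinP; exact: measurable_funX.
have [+ _] := ae_eq_integral_abs mu mD mf2.
have -> : (\int[mu]_(z in D) `|((f z) ^+ 2)%:E| = 0)%E.
  by rewrite -[RHS]f0'; apply: eq_integral => z _; rewrite gee0_abs // lee_fin sqr_ge0.
move=> /(_ erefl); apply: filterS => z H Dz.
by have /eqP := H Dz; rewrite eqe sqrf_eq0 => /eqP.
Qed.

Lemma eq_Rintegral_ae (f g : T -> R) : measurable_fun D f -> measurable_fun D g ->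
  {ae mu, forall z, D z -> f z = g z} ->
  \int[mu]_(z in D) f z = \int[mu]_(z in D) g z.
Proof.
move=> mf mg fg; rewrite /Rintegral; congr fine; apply: ae_eq_integral => //.
- exact/measurable_EFinP.
- exact/measurable_EFinP.
- by apply: filterS fg => z H Dz; rewrite H.
Qed.

End square_integrable.

(** * Reflection followed by a 2 x 2 matrix, acting on L^2 *)

Section mix.
Context {R : realType}.
Implicit Types (h w u v : R * R -> R).
Local Notation Q := (@quarter_disk R).
Local Notation D := (@half_disk R).
Local Notation mu := (area R).

Let mD : measurable (D : set (plane R)) := measurable_half_disk.
Let mQ : measurable (Q : set (plane R)) := measurable_quarter_disk.

(* In terms of the pair (h, h o mirror) on the quarter disk, [mix p q r s] is
   composition with the reflection x <-> y followed by the matrix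
   [[p, q], [r, s]]; the adjoint corresponds to the transposed matrix.  The
   value 0 on the axis keeps [mix p q r s h] measurable: there the formula
   would read [h] on the boundary of the half-disk. *)
Definition mix (p q r s : R) h (z : R * R) : R :=
  if 0 < z.1 then p * h (z.2, z.1) + q * h (- z.2, z.1)
  else if z.1 < 0 then r * h (z.2, - z.1) + s * h (- z.2, - z.1)
  else 0.

Lemma mix_right p q r s h z : Q z ->
  mix p q r s h z = p * h (transp z) + q * h (mirror (transp z)).
Proof. by case: z => x y [_ /= x0]; rewrite /mix /= x0. Qed.

Lemma mix_left p q r s h z : Q z ->
  mix p q r s h (mirror z) = r * h (transp z) + s * h (mirror (transp z)).
Proof.
by case: z => x y [_ /= x0]; rewrite /mix /= oppr_gt0 oppr_lt0 ltNge ltW //= x0 opprK.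
Qed.

Lemma mix_axis p q r s h z : axis z -> mix p q r s h z = 0.
Proof. by rewrite /axis /mix /= => ->; rewrite ltxx. Qed.

Lemma mixB p q r s u v z :
  mix p q r s u z - mix p q r s v z = mix p q r s (fun x => u x - v x) z.
Proof. by rewrite /mix; case: ifP => _; [ring | case: ifP => _; ring]. Qed.

Lemma transp_quarter z : Q z -> Q (transp z).
Proof. by move=> Qz; rewrite -quarter_disk_transp in Qz. Qed.

Lemma L2_right h : L2 D h -> L2 Q (h \o transp).
Proof.
case=> mh hi; split.
  have := measurable_fun_preserving measure_preserving_transp mQ
    (measurable_funS mD quarter_disk_sub mh).
  by rewrite quarter_disk_transp.
have [+ _] := integrable_fold hi.
by move/(integrable_preserving measure_preserving_transp mQ); rewrite quarter_disk_transp.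
Qed.

Lemma L2_mirror h : L2 D h -> L2 D (h \o mirror).
Proof.
case=> mh hi; split.
  have := measurable_fun_preserving measure_preserving_mirror mD mh.
  by congr measurable_fun; apply/funext => z; rewrite /= half_disk_mirror.
have := integrable_preserving measure_preserving_mirror mD hi.
by congr (mu.-integrable _ _); apply/funext => z; rewrite /= half_disk_mirror.
Qed.

Lemma L2_left h : L2 D h -> L2 Q (h \o mirror \o transp).
Proof. by move=> /L2_mirror/L2_right. Qed.

Lemma L2_mix p q r s h : L2 D h -> L2 D (mix p q r s h).
Proof.
move=> Lh; have Lr := L2_right Lh; have Ll := L2_left Lh.
have comb a b : L2 Q (fun z => a * h (transp z) + b * h (mirror (transp z))).
  by apply: (sqintD mQ); exact: (sqintZ mQ).
have [mr ri] : L2 Q (mix p q r s h).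
  by apply: (eq_sqint mQ _ (comb p q)) => z /mix_right ->.
have [ml li] : L2 Q (mix p q r s h \o mirror).
  by apply: (eq_sqint mQ _ (comb r s)) => z /= /mix_left ->.
have mm : @measurable_fun _ _ (plane R) R D (mix p q r s h).
  by apply: measurable_fun_fold => // z /mix_axis.
split => //; apply: integrable_unfold => //.
exact: (measurable_funX _ mm).
Qed.

(** Folded onto the quarter-disk, with one side moved by [transp], both integrands agree pointwise:
    this is the identity of a matrix and its transpose under the scalar product of R^2. *)
Lemma mix_adjoint p q r s h w : L2 D h -> L2 D w ->
  \int[mu]_(z in D) (mix p q r s h z * w z) =
  \int[mu]_(z in D) (h z * mix p r q s w z).
Proof.
move=> Lh Lw.
have Lhr := L2_right Lh; have Lhl := L2_left Lh.
have S u : L2 D u -> L2 Q u.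
  case=> m1 m2; split; first exact: (measurable_funS mD quarter_disk_sub m1).
  exact: (integrableS mD mQ quarter_disk_sub m2).
have Lwm := L2_mirror Lw; have Lhm := L2_mirror Lh.
have Lm : L2 D (mix p q r s h) := L2_mix p q r s Lh.
have Lm' : L2 D (mix p r q s w) := L2_mix p r q s Lw.
rewrite Rintegral_fold; last exact: (sqintM mD Lm Lw).
rewrite [RHS]Rintegral_fold; last exact: (sqintM mD Lh Lm').
rewrite -RintegralD //; last 2 first.
- exact: (sqintM mQ (S _ Lm) (S _ Lw)).
- exact: (sqintM mQ (S _ (L2_mirror Lm)) (S _ Lwm)).
rewrite -RintegralD //; last 2 first.
- exact: (sqintM mQ (S _ Lh) (S _ Lm')).
- exact: (sqintM mQ (S _ Lhm) (S _ (L2_mirror Lm'))).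
rewrite -[RHS]Rintegral_transp; last first.
  apply: measurable_funD.
    exact: (measurable_funM (S _ Lh).1 (S _ Lm').1).
  exact: (measurable_funM (S _ Lhm).1 (S _ (L2_mirror Lm')).1).
apply: eq_Rintegral => z /[!inE] Qz.
have Qt := transp_quarter Qz.
rewrite mix_right // mix_left // mix_right // mix_left //.
have -> : transp (transp z) = z by case: (z).
by ring.
Qed.

(** The four equations say that the product of the two matrices is the identity. On the axis [mix]
    is 0, hence the exclusion. *)
Lemma mix_mix p q r s p' q' r' s' h z : D z -> ~ axis z ->
  p * p' + q * r' = 1 -> p * q' + q * s' = 0 ->
  r * p' + s * r' = 0 -> r * q' + s * s' = 1 ->
  mix p q r s (mix p' q' r' s' h) z = h z.
Proof.
move=> Dz Az e1 e2 e3 e4.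
have : (D `\` axis) z by [].
rewrite half_diskE => -[Qz|Qz].
  rewrite mix_right // mix_right ?mix_left; try exact: transp_quarter.
  have -> : transp (transp z) = z by case: (z).
  transitivity ((p * p' + q * r') * h z + (p * q' + q * s') * h (mirror z)); first ring.
  by rewrite e1 e2; ring.
have -> : z = mirror (mirror z) by case: (z) => x y; rewrite /mirror /= opprK.
rewrite /= in Qz; move: (mirror z) Qz => {z Dz Az} z Qz.
rewrite mix_left // mix_right ?mix_left; try exact: transp_quarter.
have -> : transp (transp z) = z by case: (z).
transitivity ((r * p' + s * r') * h z + (r * q' + s * s') * h (mirror z)); first ring.
by rewrite e3 e4; ring.
Qed.

Lemma ae_off_axis (P : R * R -> Prop) :
  (forall z, D z -> ~ axis z -> P z) -> {ae mu, forall z, D z -> P z}.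
Proof.
move=> H; exists (axis : set (plane R)); split.
- exact: measurable_axis.
- exact: area_axis.
- move=> z /= nP; apply: contrapT => Az; apply: nP => Dz; exact: H.
Qed.

End mix.

(** * C^1 calculus in the plane *)

Lemma near_eq_differentiable (K : numFieldType) (V W : normedModType K)
    (f g : V -> W) (z : V) :
  {near z, f =1 g} -> differentiable f z -> differentiable g z.
Proof.
move=> fg df.
have H : g \o shift z = cst (g z) + 'd f z +o_ 0 id.
  apply/eqaddoP => e e0.
  have /diff_locally/eqaddoP/(_ e e0) := df.
  have fg0 : \forall x \near (0 : V), f (x + z) = g (x + z).
    by move: fg; rewrite (near_shift 0 z) subr0.
  apply: filterS2 fg0 => x fgx.
  by rewrite !fctE /= fgx -(nbhs_singleton fg).
apply/diff_locallyP; rewrite (diff_unique (diff_continuous df) H).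
by split => //; exact: diff_continuous.
Qed.

Section C1_calculus.
Context {R : realType}.
Implicit Types (f g p q a b : R * R -> R) (U V : set (R * R)) (z : R * R).

(** C^1 regularity with named partial derivatives, so that the rules below produce explicit formulas
    for gradients, which are later estimated term by term. *)
Definition has_C1_grad U f p q := forall z, U z ->
  [/\ differentiable f z, 'D_((1 : R), (0 : R)) f z = p z,
      'D_((0 : R), (1 : R)) f z = q z,
      {for z, continuous p} & {for z, continuous q}].

Lemma derive_plane f z (s t : R) : differentiable f z ->
  'd f z (s, t) = s * 'D_((1 : R), (0 : R)) f z + t * 'D_((0 : R), (1 : R)) f z.
Proof.
move=> df.
have -> : (s, t) = s *: ((1, 0) : R * R) + t *: ((0, 1) : R * R) :> R * R.
  by congr pair; rewrite /= /GRing.scale /= ?mulr1 ?mulr0 ?addr0 ?add0r.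
by rewrite linearD !linearZ !deriveE.
Qed.

Lemma has_C1_grad_on U f p q : open U -> has_C1_grad U f p q -> C1_on U f.
Proof.
move=> oU H z Uz; have [df _ _ cp cq] := H z Uz; split => //.
have gE : \forall x \near z, (p x, q x) = grad f x.
  have : nbhs z U by exact: open_nbhs_nbhs.
  by apply: filterS => x /H[_ <- <-].
have -> : {for z, continuous (grad f)} = (grad f x @[x --> z] --> (p z, q z)).
  by rewrite (nbhs_singleton gE).
apply: (cvg_trans (near_eq_cvg gE)).
exact: (cvg_pair cp cq).
Qed.

Lemma C1_on_has_grad U f : C1_on U f ->
  has_C1_grad U f (fun z => (grad f z).1) (fun z => (grad f z).2).
Proof.
move=> H z Uz; have [df cg] := H z Uz; split.
- exact: df.
- exact: erefl.
- exact: erefl.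
- apply: (continuous_comp cg); exact: cvg_fst.
- apply: (continuous_comp cg); exact: cvg_snd.
Qed.

Lemma sub_has_C1_grad U V f p q : U `<=` V -> has_C1_grad V f p q -> has_C1_grad U f p q.
Proof. by move=> UV H z /UV/H. Qed.

Lemma has_C1_grad_cst U (c : R) : has_C1_grad U (fun _ => c) (fun _ => 0) (fun _ => 0).
Proof.
move=> z Uz; split; first exact: differentiable_cst.
- exact: derive_cst.
- exact: derive_cst.
- exact: cvg_cst.
- exact: cvg_cst.
Qed.

Lemma fst_linear : linear (fst : R * R -> R). Proof. by []. Qed.
Lemma snd_linear : linear (snd : R * R -> R). Proof. by []. Qed.

Lemma has_C1_grad_linear U (f : {linear (R * R)%type -> R}) :
  has_C1_grad U f (fun _ => f (1, 0)) (fun _ => f (0, 1)).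
Proof.
move=> z Uz.
have cf : continuous f.
  have -> : (f : R * R -> R) = (fun z => z.1 * f (1, 0) + z.2 * f (0, 1)).
    apply/funext => -[s t] /=.
    have -> : (s, t) = s *: ((1, 0) : R * R) + t *: ((0, 1) : R * R) :> R * R.
      by congr pair; rewrite /= /GRing.scale /= ?mulr1 ?mulr0 ?addr0 ?add0r.
    by rewrite linearD !linearZ.
  move=> x; apply: cvgD.
    by apply: cvgM; [exact: cvg_fst | exact: cvg_cst].
  by apply: cvgM; [exact: cvg_snd | exact: cvg_cst].
have df : differentiable f z by apply: linear_differentiable.
split => //.
- by rewrite deriveE // diff_lin.
- by rewrite deriveE // diff_lin.
- exact: cvg_cst.
- exact: cvg_cst.
Qed.

HB.instance Definition _ := GRing.isLinear.Build R (R * R)%type R _ (fst : R * R -> R) fst_linear.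
HB.instance Definition _ := GRing.isLinear.Build R (R * R)%type R _ (snd : R * R -> R) snd_linear.

Lemma has_C1_grad_fst U : has_C1_grad U (fun z => z.1) (fun _ => 1) (fun _ => 0).
Proof. exact: (@has_C1_grad_linear U (fst : {linear (R * R)%type -> R})). Qed.

Lemma has_C1_grad_snd U : has_C1_grad U (fun z => z.2) (fun _ => 0) (fun _ => 1).
Proof. exact: (@has_C1_grad_linear U (snd : {linear (R * R)%type -> R})). Qed.

Lemma has_C1_gradD U f g p q r s : has_C1_grad U f p q -> has_C1_grad U g r s ->
  has_C1_grad U (fun z => f z + g z) (fun z => p z + r z) (fun z => q z + s z).
Proof.
move=> Hf Hg z Uz; have [df e1 e2 cp cq] := Hf z Uz.
have [dg e3 e4 cr cs] := Hg z Uz; split.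
- exact: differentiableD.
- by rewrite deriveD ?e1 ?e3 //; exact: diff_derivable.
- by rewrite deriveD ?e2 ?e4 //; exact: diff_derivable.
- exact: cvgD.
- exact: cvgD.
Qed.

Lemma has_C1_gradM U f g p q r s : has_C1_grad U f p q -> has_C1_grad U g r s ->
  has_C1_grad U (fun z => f z * g z) (fun z => p z * g z + f z * r z)
    (fun z => q z * g z + f z * s z).
Proof.
move=> Hf Hg z Uz; have [df e1 e2 cp cq] := Hf z Uz.
have [dg e3 e4 cr cs] := Hg z Uz.
have cf := differentiable_continuous df; have cg := differentiable_continuous dg.
split.
- exact: differentiableM.
- by rewrite deriveM ?e1 ?e3 //; [rewrite addrC mulrC | exact: diff_derivable | exact: diff_derivable].
- by rewrite deriveM ?e2 ?e4 //; [rewrite addrC mulrC | exact: diff_derivable | exact: diff_derivable].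
- by apply: cvgD; apply: cvgM.
- by apply: cvgD; apply: cvgM.
Qed.

Lemma has_C1_grad_comp1 U (phi dphi : R -> R) f p q : has_C1_grad U f p q ->
  (forall z, U z -> is_derive (f z) 1 phi (dphi (f z)) /\ {for f z, continuous dphi}) ->
  has_C1_grad U (fun z => phi (f z)) (fun z => dphi (f z) * p z)
    (fun z => dphi (f z) * q z).
Proof.
move=> Hf Hphi z Uz; have [df e1 e2 cp cq] := Hf z Uz.
have [[dphi1 dphi2] cphi] := Hphi z Uz.
have dp : differentiable phi (f z) by exact/derivable1_diffP.
have cf := differentiable_continuous df.
have dd : differentiable (phi \o f) z by exact: differentiable_comp.
have E v : 'D_v (phi \o f) z = dphi (f z) * 'D_v f z.
  rewrite !deriveE // diff_comp //= diff1E // derive1E dphi2.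
  by rewrite /GRing.scale /= mulrC.
split => //.
- by rewrite E e1.
- by rewrite E e2.
- by apply: cvgM => //; exact: (continuous_comp cf cphi).
- by apply: cvgM => //; exact: (continuous_comp cf cphi).
Qed.

Lemma has_C1_grad_comp2 U V F P Q a b p q r s : has_C1_grad V F P Q ->
  has_C1_grad U a p q -> has_C1_grad U b r s ->
  (forall z, U z -> V (a z, b z)) ->
  has_C1_grad U (fun z => F (a z, b z))
    (fun z => P (a z, b z) * p z + Q (a z, b z) * r z)
    (fun z => P (a z, b z) * q z + Q (a z, b z) * s z).
Proof.
move=> HF Ha Hb HU z Uz; have [da e1 e2 cp cq] := Ha z Uz.
have [db e3 e4 cr cs] := Hb z Uz.
have [dF E1 E2 cP cQ] := HF _ (HU z Uz).
have ca := differentiable_continuous da; have cb := differentiable_continuous db.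
have dab : differentiable (fun z => (a z, b z)) z by exact: differentiable_pair.
have dd : differentiable (F \o (fun z => (a z, b z))) z.
  exact: differentiable_comp.
have cab := differentiable_continuous dab.
have E v : 'D_v (F \o (fun z => (a z, b z))) z =
    P (a z, b z) * 'D_v a z + Q (a z, b z) * 'D_v b z.
  rewrite deriveE // diff_comp //= diff_pair //= derive_plane // E1 E2 !deriveE //.
  by rewrite mulrC [X in _ + X]mulrC.
split => //.
- by rewrite E e1 e3.
- by rewrite E e2 e4.
- by apply: cvgD; apply: cvgM => //; exact: (continuous_comp cab).
- by apply: cvgD; apply: cvgM => //; exact: (continuous_comp cab).
Qed.


Lemma has_C1_gradZ U c f p q : has_C1_grad U f p q ->
  has_C1_grad U (fun z => c * f z) (fun z => c * p z) (fun z => c * q z).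
Proof.
move=> Hf z Uz.
have [d1 e1 e2 c1 c2] := has_C1_gradM (has_C1_grad_cst c) Hf Uz.
split; first exact: d1.
- by rewrite e1 mul0r add0r.
- by rewrite e2 mul0r add0r.
- by have [_ _ _ cp _] := Hf z Uz; apply: cvgM => //; exact: cvg_cst.
- by have [_ _ _ _ cq] := Hf z Uz; apply: cvgM => //; exact: cvg_cst.
Qed.

Lemma eq_has_C1_grad U f g p q : open U -> (forall z, U z -> f z = g z) ->
  has_C1_grad U f p q -> has_C1_grad U g p q.
Proof.
move=> oU fg Hf z Uz; have [df e1 e2 cp cq] := Hf z Uz.
have nfg : {near z, f =1 g}.
  by have : nbhs z U by [exact: open_nbhs_nbhs]; apply: filterS => x /fg.
split => //.
- exact: near_eq_differentiable df.
- by rewrite -(near_eq_derive _ nfg).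
- by rewrite -(near_eq_derive _ nfg).
Qed.

Lemma near_grad_eq z f g : {near z, f =1 g} -> grad f z = grad g z.
Proof. by move=> fg; congr pair; apply: near_eq_derive. Qed.

(** * A C^1 step function *)

Definition pos_sq (t : R) : R := (Num.max t 0) ^+ 2.

Lemma max0E (t : R) : Num.max t 0 = (t + `|t|) / 2.
Proof.
have [t0|t0] := leP t 0; first by rewrite ler0_norm //; ring.
by rewrite gtr0_norm //; field.
Qed.

Lemma max0_continuous : continuous (fun t : R => Num.max t 0).
Proof.
have -> : (fun t : R => Num.max t 0) = (fun t => (t + `|t|) / 2).
  by apply/funext => t; exact: max0E.
move=> t; apply: cvgM; last exact: cvg_cst.
by apply: cvgD; [exact: cvg_id | exact: norm_continuous].
Qed.

Lemma pos_sq_derive (t : R) : is_derive t 1 pos_sq (2 * Num.max t 0).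
Proof.
have [t0|t0|->] := ltgtP t 0.
- rewrite mulr0.
  apply: (near_eq_is_derive (f := cst (0 : R))) => //.
  by near=> x; rewrite /pos_sq max_r ?expr0n //; apply/ltW; near: x; exact: lt_nbhsl.
- apply: (near_eq_is_derive (f := fun x : R => x ^+ 2)) => //.
    by near=> x; rewrite /pos_sq max_l //; apply/ltW; near: x; exact: lt_nbhsr.
  have := @is_deriveX _ _ (@id R) 2 t 1 1 (is_derive_id _ _).
  by congr is_derive; rewrite /= expr1 /GRing.scale /= mulr1.
(* At 0 the difference quotient in [h] is [Num.max h 0], which is continuous. *)
- rewrite mulr0.
  have H : h^-1 *: ((pos_sq \o shift 0) (h *: 1) - pos_sq 0) @[h --> 0^'] --> (0 : R).
    apply: (@cvg_trans _ ((Num.max h 0) @[h --> (0 : R)^'])).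
      apply: near_eq_cvg; near=> h.
      have h0 : h != 0 by near: h; exact: nbhs_dnbhs_neq.
      rewrite /= /pos_sq maxxx expr0n /= subr0 addr0 /GRing.scale /= mulr1.
      have [h1|h1|] := ltgtP h 0; last by move/eqP: h0.
      + by rewrite expr0n mulr0.
      + by rewrite expr2 mulKf.
    have C : Num.max h 0 @[h --> (0 : R)] --> Num.max (0 : R) 0 := @max0_continuous 0.
    by rewrite maxxx in C; exact: cvg_within_filter C.
  split; first by apply/cvg_ex; exists 0.
  exact: cvg_lim H.
Unshelve. all: by end_near. Qed.

(** A C^1 step from 0 on t <= 0 to 1 on t >= 1: the inner square flattens it at 1, the outer one at
    0. *)
Definition smoothstep (t : R) : R := pos_sq (1 - pos_sq (1 - t)).
Definition dsmoothstep (t : R) : R :=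
  4 * (Num.max (1 - pos_sq (1 - t)) 0 * Num.max (1 - t) 0).

Lemma pos_sq_ge0 t : 0 <= pos_sq t. Proof. exact: sqr_ge0. Qed.

Lemma pos_sq_le0 t : t <= 0 -> pos_sq t = 0.
Proof. by move=> t0; rewrite /pos_sq max_r // expr0n. Qed.

Lemma smoothstep_ge0 t : 0 <= smoothstep t. Proof. exact: pos_sq_ge0. Qed.

Lemma smoothstep_le1 t : smoothstep t <= 1.
Proof.
rewrite /smoothstep; have := pos_sq_ge0 (1 - t); move: (pos_sq _) => x x0.
rewrite /pos_sq; have [_|h] := leP (1 - x) 0; first by rewrite expr0n.
by rewrite expr_le1 //; lra.
Qed.

Lemma smoothstep_le0 t : t <= 0 -> smoothstep t = 0.
Proof.
move=> t0; apply: pos_sq_le0; rewrite /pos_sq max_l; last by lra.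
by rewrite subr_le0 expr_ge1 //; lra.
Qed.

Lemma smoothstep_ge1 t : 1 <= t -> smoothstep t = 1.
Proof.
move=> t0; rewrite /smoothstep (@pos_sq_le0 (1 - t)) ?subr0; last by lra.
by rewrite /pos_sq max_l ?expr1n //; lra.
Qed.

Lemma dsmoothstep_ge0 t : 0 <= dsmoothstep t.
Proof. by rewrite /dsmoothstep !mulr_ge0 // le_max lexx orbT. Qed.

Lemma dsmoothstep_le4 t : 0 <= t -> dsmoothstep t <= 4.
Proof.
move=> t0; rewrite /dsmoothstep -[leRHS]mulr1 ler_pM2l //.
have A : 0 <= Num.max (1 - pos_sq (1 - t)) 0 <= 1.
  rewrite le_max lexx orbT /= ge_max ler01 andbT.
  by have := pos_sq_ge0 (1 - t); lra.
have B : 0 <= Num.max (1 - t) 0 <= 1.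
  by rewrite le_max lexx orbT /= ge_max ler01 andbT; lra.
case/andP: A => A1 A2; case/andP: B => B1 B2.
by rewrite -[leRHS]mulr1 ler_pM.
Qed.

Lemma dsmoothstep_le0 (t : R) : t <= 0 -> dsmoothstep t = 0.
Proof.
move=> t0; rewrite /dsmoothstep [X in 4 * (X * _)]max_r ?mul0r ?mulr0 //.
rewrite /pos_sq max_l; last by lra.
by rewrite subr_le0 expr_ge1 //; lra.
Qed.

Lemma dsmoothstep_ge1 t : 1 <= t -> dsmoothstep t = 0.
Proof. by move=> t0; rewrite /dsmoothstep [X in 4 * (_ * X)]max_r ?mulr0 //; lra. Qed.

Lemma smoothstep_derive (t : R) : is_derive t 1 smoothstep (dsmoothstep t).
Proof.
have d1 (x : R) : is_derive x 1 (fun s : R => 1 - s) (-1).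
  by rewrite -[X in is_derive _ _ _ X]add0r; apply: is_deriveB.
have D1 := pos_sq_derive (1 - t).
have D2 : is_derive t 1 (fun s : R => pos_sq (1 - s)) (2 * Num.max (1 - t) 0 * -1).
  exact: is_derive1_comp.
have D3 : is_derive t 1 (fun s : R => 1 - pos_sq (1 - s)) (0 - 2 * Num.max (1 - t) 0 * -1).
  exact: is_deriveB.
have D4 := pos_sq_derive (1 - pos_sq (1 - t)).
have := @is_derive1_comp _ pos_sq (fun s : R => 1 - pos_sq (1 - s)) t _ _ D4 D3.
by congr is_derive; rewrite /dsmoothstep; ring.
Qed.

Lemma pos_sq_continuous : continuous pos_sq.
Proof.
by move=> t; apply/differentiable_continuous/derivable1_diffP; case: (pos_sq_derive t).
Qed.

Lemma dsmoothstep_continuous : continuous dsmoothstep.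
Proof.
have c1 : continuous (fun s : R => 1 - s).
  by move=> t; apply: cvgB; [exact: cvg_cst | exact: cvg_id].
have m1 : continuous (fun s : R => Num.max (1 - s) 0).
  move=> t; apply: (@continuous_comp _ _ _ (fun s : R => 1 - s) (fun t : R => Num.max t 0)); last exact: max0_continuous.
  exact: c1.
have m2 : continuous (fun s : R => 1 - pos_sq (1 - s)).
  move=> t; apply: cvgB; first exact: cvg_cst.
  by apply: (@continuous_comp _ _ _ (fun s : R => 1 - s) pos_sq); [exact: c1 | exact: pos_sq_continuous].
have m3 : continuous (fun s : R => Num.max (1 - pos_sq (1 - s)) 0).
  move=> t; apply: (@continuous_comp _ _ _ (fun s : R => 1 - pos_sq (1 - s)) (fun t : R => Num.max t 0)); last exact: max0_continuous.
  exact: m2.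
by move=> t; exact: (cvgM (cvg_cst _) (cvgM (m3 t) (m1 t))).
Qed.

End C1_calculus.

(** * C^1 versions of sign and absolute value *)

Section cutoffs.
Context {R : realType}.
Variable (e : R).
Hypothesis e0 : 0 < e.
Implicit Types x : R.

(** The transitions are nested: [soft_sgn] varies only for |x| < e, where [soft_abs] is still 0,
    while [soft_abs] rises between e and 2e and is |x| afterwards. So the large derivative of
    [soft_sgn] occurs only where the flattened coordinate is 0. *)
Definition soft_sgn x := smoothstep (x / e) - smoothstep (- x / e).
Definition dsoft_sgn x := (dsmoothstep (x / e) + dsmoothstep (- x / e)) / e.

Definition soft_pos x := x * smoothstep (x / e - 1).
Definition dsoft_pos x := smoothstep (x / e - 1) + x * (dsmoothstep (x / e - 1) / e).

Definition soft_abs x := soft_pos x + soft_pos (- x).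
Definition dsoft_abs x := dsoft_pos x - dsoft_pos (- x).

Lemma is_derive_affine (s t x : R) : is_derive x 1 (fun y => s * y + t) s.
Proof.
have := @is_deriveD _ _ _ (fun y : R => s * y) (cst t) x 1 _ _
  (is_deriveZ s (is_derive_id x 1)) (is_derive_cst t x 1).
by rewrite addr0 /GRing.scale /= mulr1.
Qed.

Lemma is_derive_smoothstep_affine (s t x : R) :
  is_derive x 1 (fun y => smoothstep (s * y + t)) (dsmoothstep (s * x + t) * s).
Proof.
exact: (@is_derive1_comp _ smoothstep (fun y => s * y + t) x _ _
  (smoothstep_derive _) (is_derive_affine s t x)).
Qed.

Lemma continuous_dsmoothstep_affine (s t : R) :
  continuous (fun y => dsmoothstep (s * y + t)).
Proof.
move=> x; apply: (@continuous_comp _ _ _ (fun y : R => s * y + t) dsmoothstep).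
  by apply: cvgD; [apply: cvgM; [exact: cvg_cst | exact: cvg_id] | exact: cvg_cst].
exact: dsmoothstep_continuous.
Qed.

Lemma continuous_smoothstep_affine (s t : R) :
  continuous (fun y => smoothstep (s * y + t)).
Proof.
move=> x; apply/differentiable_continuous/derivable1_diffP.
by case: (is_derive_smoothstep_affine s t x).
Qed.

Lemma soft_sgn_derive x : is_derive x 1 soft_sgn (dsoft_sgn x).
Proof.
have D1 := is_derive_smoothstep_affine e^-1 0 x.
have D2 := is_derive_smoothstep_affine (- e^-1) 0 x.
have := is_deriveB D1 D2.
have -> : (fun y => smoothstep (e^-1 * y + 0)) - (fun y => smoothstep (- e^-1 * y + 0)) = soft_sgn.
  apply/funext => y; rewrite /soft_sgn !fctE; congr (smoothstep _ - smoothstep _); ring.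
congr is_derive; rewrite /dsoft_sgn.
have -> : e^-1 * x + 0 = x / e by ring.
have -> : - e^-1 * x + 0 = - x / e by ring.
ring.
Qed.

Lemma dsoft_sgn_continuous : continuous dsoft_sgn.
Proof.
have -> : dsoft_sgn = (fun y => (dsmoothstep (e^-1 * y + 0) + dsmoothstep (- e^-1 * y + 0)) * e^-1).
  apply/funext => y; rewrite /dsoft_sgn; congr ((dsmoothstep _ + dsmoothstep _) * _); ring.
move=> x; apply: cvgM; last exact: cvg_cst.
apply: cvgD; exact: continuous_dsmoothstep_affine.
Qed.

Lemma soft_pos_derive x : is_derive x 1 soft_pos (dsoft_pos x).
Proof.
have D1 := is_derive_smoothstep_affine e^-1 (-1) x.
have := is_deriveM (is_derive_id x 1) D1.
have -> : id * (fun y => smoothstep (e^-1 * y + -1)) = soft_pos.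
  by apply/funext => y; rewrite /soft_pos !fctE; congr (_ * smoothstep _); ring.
congr is_derive; rewrite /dsoft_pos /GRing.scale /=.
have -> : e^-1 * x + -1 = x / e - 1 by ring.
ring.
Qed.

Lemma dsoft_pos_continuous : continuous dsoft_pos.
Proof.
have -> : dsoft_pos = (fun y => smoothstep (e^-1 * y + -1) + y * (dsmoothstep (e^-1 * y + -1) * e^-1)).
  apply/funext => y; rewrite /dsoft_pos.
  have -> : e^-1 * y + -1 = y / e - 1 by ring.
  by [].
move=> x; apply: cvgD; first exact: continuous_smoothstep_affine.
apply: cvgM; first exact: cvg_id.
by apply: cvgM; [exact: continuous_dsmoothstep_affine | exact: cvg_cst].
Qed.

Lemma soft_abs_derive x : is_derive x 1 soft_abs (dsoft_abs x).
Proof.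
have D1 : is_derive x 1 (fun y : R => soft_pos (- y)) (dsoft_pos (- x) * -1).
  exact: (@is_derive1_comp _ soft_pos (@GRing.opp R) x _ _ (soft_pos_derive _) (is_deriveNid _ _)).
have := is_deriveD (soft_pos_derive x) D1.
by congr is_derive; rewrite /dsoft_abs; ring.
Qed.

Lemma dsoft_abs_continuous : continuous dsoft_abs.
Proof.
move=> x; apply: cvgB; first exact: dsoft_pos_continuous.
apply: (@continuous_comp _ _ _ (@GRing.opp R) dsoft_pos); last exact: dsoft_pos_continuous.
exact: opp_continuous.
Qed.

Lemma soft_sgn_far x : e <= `|x| -> soft_sgn x = Num.sg x /\ dsoft_sgn x = 0.
Proof.
rewrite /soft_sgn /dsoft_sgn; have [x0|x0|->] := ltgtP x 0; last by rewrite normr0 leNgt e0.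
- rewrite ltr0_norm // => ex.
  have h1 : x / e <= 0 by rewrite pmulr_lle0 ?invr_gt0 //; lra.
  have h2 : 1 <= - x / e by rewrite ler_pdivlMr //; lra.
  rewrite smoothstep_le0 // smoothstep_ge1 // dsmoothstep_le0 // dsmoothstep_ge1 //.
  by rewrite ltr0_sg // addr0 mul0r sub0r.
- rewrite gtr0_norm // => ex.
  have h1 : - x / e <= 0 by rewrite pmulr_lle0 ?invr_gt0 //; lra.
  have h2 : 1 <= x / e by rewrite ler_pdivlMr //; lra.
  rewrite smoothstep_ge1 // smoothstep_le0 // dsmoothstep_ge1 // dsmoothstep_le0 //.
  by rewrite gtr0_sg // addr0 mul0r subr0.
Qed.

Lemma soft_sgn_bound x : `|soft_sgn x| <= 1.
Proof.
rewrite /soft_sgn ler_norml.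
have := smoothstep_ge0 (x / e); have := smoothstep_le1 (x / e).
have := smoothstep_ge0 (- x / e); have := smoothstep_le1 (- x / e).
by lra.
Qed.

Lemma soft_abs_even x : soft_abs (- x) = soft_abs x.
Proof. by rewrite /soft_abs opprK addrC. Qed.

Lemma dsoft_abs_odd x : dsoft_abs (- x) = - dsoft_abs x.
Proof. by rewrite /dsoft_abs opprK opprB. Qed.

Lemma soft_pos_near x : x <= e -> soft_pos x = 0 /\ dsoft_pos x = 0.
Proof.
move=> xe; have h : x / e - 1 <= 0 by rewrite subr_le0 ler_pdivrMr // mul1r.
by rewrite /soft_pos /dsoft_pos smoothstep_le0 // dsmoothstep_le0 // mul0r !mulr0 addr0.
Qed.

Lemma soft_pos_far x : 2 * e <= x -> soft_pos x = x /\ dsoft_pos x = 1.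
Proof.
move=> xe; have h : 1 <= x / e - 1 by rewrite lerBrDr ler_pdivlMr //; lra.
by rewrite /soft_pos /dsoft_pos smoothstep_ge1 // dsmoothstep_ge1 // mul0r mulr0 addr0 mulr1.
Qed.

(** In the transition x / e is at most 2, so 9 = 1 + 2 * 4, with 1 bounding [smoothstep] and 4 its
    derivative. The bound does not depend on [e]. *)
Lemma dsoft_pos_bound x : 0 <= x -> 0 <= dsoft_pos x <= 9.
Proof.
move=> x0; have [xe|xe] := leP x e.
  by have [_ ->] := soft_pos_near xe; lra.
have [xe2|xe2] := leP (2 * e) x.
  by have [_ ->] := soft_pos_far xe2; lra.
rewrite /dsoft_pos.
have h0 : 0 <= x / e - 1 by rewrite subr_ge0 ler_pdivlMr // mul1r ltW.
have h1 : x / e <= 2 by rewrite ler_pdivrMr //; lra.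
have h2 := dsmoothstep_ge0 (x / e - 1); have h3 := dsmoothstep_le4 h0.
have h4 := smoothstep_ge0 (x / e - 1); have h5 := smoothstep_le1 (x / e - 1).
have -> : x * (dsmoothstep (x / e - 1) / e) = (x / e) * dsmoothstep (x / e - 1) by ring.
by nra.
Qed.

Lemma soft_abs_bound x : 0 <= soft_abs x <= `|x|.
Proof.
wlog x0 : x / 0 <= x => [H|].
  have [/H//|/ltW x0] := leP 0 x.
  by rewrite -soft_abs_even -normrN H // oppr_ge0.
rewrite /soft_abs ger0_norm // (_ : soft_pos (- x) = 0); last first.
  have xe : - x <= e by rewrite lerNl (le_trans _ x0) // oppr_le0 ltW.
  by have [->] := soft_pos_near xe.
rewrite addr0 /soft_pos.
have h4 := smoothstep_ge0 (x / e - 1); have h5 := smoothstep_le1 (x / e - 1).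
by rewrite mulr_ge0 //= -[leRHS]mulr1 ler_wpM2l.
Qed.

Lemma dsoft_abs_bound x : `|dsoft_abs x| <= 9.
Proof.
wlog x0 : x / 0 <= x => [H|].
  have [/H//|/ltW x0] := leP 0 x.
  by rewrite -normrN -dsoft_abs_odd H // oppr_ge0.
rewrite /dsoft_abs (_ : dsoft_pos (- x) = 0); last first.
  have xe : - x <= e by rewrite lerNl (le_trans _ x0) // oppr_le0 ltW.
  by have [_ ->] := soft_pos_near xe.
by rewrite subr0 ler_norml; have := dsoft_pos_bound x0; lra.
Qed.

Lemma soft_abs_near x : `|x| <= e -> soft_abs x = 0 /\ dsoft_abs x = 0.
Proof.
rewrite ler_norml => xe; rewrite /soft_abs /dsoft_abs.
have [|-> ->] := @soft_pos_near x; first lra.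
have [|-> ->] := @soft_pos_near (- x); first lra.
by rewrite addr0 subr0.
Qed.

Lemma soft_abs_far x : 2 * e <= `|x| ->
  soft_abs x = `|x| /\ dsoft_abs x = Num.sg x.
Proof.
wlog x0 : x / 0 <= x => [H|].
  have [/H//|/ltW x0 h] := leP 0 x.
  have [||h1 h2] := H (- x); [by rewrite oppr_ge0 | by rewrite normrN |].
  split; first by rewrite -soft_abs_even h1 normrN.
  by rewrite -[dsoft_abs x]opprK -dsoft_abs_odd h2 sgrN opprK.
rewrite ger0_norm // /soft_abs /dsoft_abs => h.
have xe : - x <= e by rewrite lerNl (le_trans _ x0) // oppr_le0 ltW.
have [-> ->] := soft_pos_near xe; have [-> ->] := soft_pos_far h.
by rewrite addr0 subr0 gtr0_sg // (lt_le_trans _ h) // mulr_gt0.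
Qed.

End cutoffs.

(** * The closed half-disk *)

Section half_disk_closure.
Context {R : realType}.

Lemma closure_half_diskP (z : R * R) :
  closure (@half_disk R) z <-> z.1 ^+ 2 + z.2 ^+ 2 <= 1 /\ 0 <= z.2.
Proof.
split.
  have : closed [set z : R * R | z.1 ^+ 2 + z.2 ^+ 2 <= 1 /\ 0 <= z.2].
    have -> : [set z : R * R | z.1 ^+ 2 + z.2 ^+ 2 <= 1 /\ 0 <= z.2] =
        (fun z => z.1 ^+ 2 + z.2 ^+ 2) @^-1` [set t | t <= 1] `&`
        (fun z => z.2) @^-1` [set t | 0 <= t] by [].
    apply: closedI; apply: closed_comp; try exact: closed_le; try exact: closed_ge.
      move=> x _; apply: cvgD; rewrite !expr2; apply: cvgM;
        (exact: continuous_fst_plane || exact: continuous_snd_plane).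
    by move=> x _; exact: continuous_snd_plane.
  move=> clo clz; apply: clo; apply: closure_subset clz => x [h1 h2].
  by split; exact: ltW.
case: z => x y /= [h1 h2] A /nbhs_ballP[r /= r0 rA].
pose t := Num.min (r / 2) (1 / 2).
have t0 : 0 < t by rewrite lt_min !divr_gt0.
have tr : t <= r / 2 by rewrite ge_min lexx.
have t1 : t <= 1 / 2 by rewrite ge_min lexx orbT.
have y1 : y <= 1 by have := sqr_ge0 x; nra.
have x1 : -1 <= x <= 1.
  by have ? := sqr_ge0 y; apply/andP; split; nra.
(* The point is moved by the fraction [t] towards the interior point (0, 1/2). *)
exists ((1 - t) * x, (1 - t) * y + t / 2); split; last first.
  apply: rA; split => /=; rewrite /ball /= ltr_norml; nra.
split => /=; last by nra.
have : ((1 - t) * x) ^+ 2 + ((1 - t) * y + t / 2) ^+ 2 =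
   (1 - t) ^+ 2 * (x ^+ 2 + y ^+ 2) + (1 - t) * t * y + t ^+ 2 / 4 by field.
move=> ->.
have a1 : (1 - t) ^+ 2 * (x ^+ 2 + y ^+ 2) <= (1 - t) ^+ 2.
  by rewrite -[leRHS]mulr1 ler_wpM2l // sqr_ge0.
have a2 : (1 - t) * t * y <= (1 - t) * t.
  by rewrite -[leRHS]mulr1 ler_wpM2l //; nra.
by nra.
Qed.

Lemma compact_closure_half_disk : compact (closure (@half_disk R)).
Proof.
have : compact (`[-1, 1]%classic `*` `[-1, 1]%classic : set (R * R)).
  by apply: compact_setX; exact: segment_compact.
move/(subclosed_compact (@closed_closure _ (@half_disk R))); apply.
move=> [x y] /closure_half_diskP /= [h1 h2]; split => /=; rewrite in_itv /=.
- by have ? := sqr_ge0 y; apply/andP; split; nra.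
- by have ? := sqr_ge0 x; apply/andP; split; nra.
Qed.

Lemma bounded_on_closure (f : R * R -> R) :
  (forall z, closure (@half_disk R) z -> {for z, continuous f}) ->
  exists M, forall z, closure (@half_disk R) z -> `|f z| <= M.
Proof.
move=> cf.
have cpt := compact_closure_half_disk.
have cK : {within closure (@half_disk R), continuous f}.
  by apply: continuous_in_subspaceT => z; rewrite inE => /cf.
have /compact_bounded[M [_ HM]] := continuous_compact cK cpt.
exists (M + 1) => z clz; apply: HM; first by rewrite ltrDl.
by exists z.
Qed.

End half_disk_closure.

Section norm_bounds.
Context {R : realDomainType}.
Implicit Types x y X Y : R.

Lemma ler_normM x y X Y : `|x| <= X -> `|y| <= Y -> `|x * y| <= X * Y.
Proof. by move=> hx hy; rewrite normrM ler_pM. Qed.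

Lemma ler_normDD x y X Y : `|x| <= X -> `|y| <= Y -> `|x + y| <= X + Y.
Proof. by move=> hx hy; apply: le_trans (ler_normD _ _) _; exact: lerD. Qed.

Lemma ler_normBD x y X Y : `|x| <= X -> `|y| <= Y -> `|x - y| <= X + Y.
Proof. by move=> hx hy; rewrite ler_normDD ?normrN. Qed.

End norm_bounds.

Section gradient_equations.
Context {R : realType}.
Implicit Types (f p q : R * R -> R).

Lemma eq_continuous_at (U : set (R * R)) p p' : open U -> (forall z, U z -> p z = p' z) ->
  forall z, U z -> {for z, continuous p} -> {for z, continuous p'}.
Proof.
move=> oU pp' z Uz cp.
have n : {near z, p =1 p'}.
  by have : nbhs z U by [exact: open_nbhs_nbhs]; apply: filterS => x /pp'.
rewrite /prop_for /continuous_at -(pp' z Uz).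
by apply: (cvg_trans (near_eq_cvg n)); exact: cp.
Qed.

Lemma eq_grad_C1_grad (U : set (R * R)) f p q p' q' : open U ->
  (forall z, U z -> p z = p' z) -> (forall z, U z -> q z = q' z) ->
  has_C1_grad U f p q -> has_C1_grad U f p' q'.
Proof.
move=> oU pp qq H z Uz; have [df e1 e2 cp cq] := H z Uz; split => //.
- by rewrite -pp.
- by rewrite -qq.
- exact: eq_continuous_at pp _ Uz cp.
- exact: eq_continuous_at qq _ Uz cq.
Qed.

End gradient_equations.

(** * The smoothed transplant: regularity and boundary values *)

Section smoothed_transplant.
Context {R : realType}.
Variables (a k e : R) (f fp fq : R * R -> R) (U : set (R * R)).
Hypotheses (e0 : 0 < e) (oU : open U) (fC1 : has_C1_grad U f fp fq).
Implicit Types (z : R * R) (O : set (R * R)).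

Local Notation b z := (soft_abs e z.1).
Local Notation db z := (dsoft_abs e z.1).
Local Notation S z := (soft_sgn e z.1).
Local Notation dS z := (dsoft_sgn e z.1).

Definition radius2 z := z.1 ^+ 2 + z.2 ^+ 2.
(** It is 0 for |z| <= 3e and 1 for |z|^2 >= 10 e^2. The radius 3e exceeds the half-width 2e of the
    flattened strip, so the cutoff covers the real segment |x| <= 2e, and in the rest of the strip
    the height stays above 2e. *)
Definition cutoff z := smoothstep (radius2 z / e ^+ 2 - 9).
Definition dcutoff z := dsmoothstep (radius2 z / e ^+ 2 - 9) * (2 / e ^+ 2).

(* [transplant a k f] with x replaced by the flattened coordinate [soft_abs],
   which is constant near 0, and y by a [Y] such that |z| is preserved.
   Preserving |z| is what keeps the Dirichlet condition on the arc. *)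
Definition smoothed (Y : R * R -> R) z :=
  k * (cutoff z * (a * S z * f (- a * Y z, b z) - f (a * Y z, b z))).

Definition smoothed_dx (Y Yp : R * R -> R) z :=
  k * (dcutoff z * z.1 * (a * S z * f (- a * Y z, b z) - f (a * Y z, b z)) +
       cutoff z *
         (a * dS z * f (- a * Y z, b z) +
          a * S z * (fp (- a * Y z, b z) * (- a * Yp z) + fq (- a * Y z, b z) * db z) -
          (fp (a * Y z, b z) * (a * Yp z) + fq (a * Y z, b z) * db z))).

Definition smoothed_dy (Y Yq : R * R -> R) z :=
  k * (dcutoff z * z.2 * (a * S z * f (- a * Y z, b z) - f (a * Y z, b z)) +
       cutoff z *
         (a * S z * (fp (- a * Y z, b z) * (- a * Yq z)) -
          fp (a * Y z, b z) * (a * Yq z))).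

(** [Y] is a parameter because two ordinates occur: [height] above the real axis, and y itself near
    the axis for |x| > 2e. *)
Lemma smoothed_C1 O Y Yp Yq : open O -> has_C1_grad O Y Yp Yq ->
  (forall z, O z -> U (- a * Y z, b z) /\ U (a * Y z, b z)) ->
  has_C1_grad O (smoothed Y) (smoothed_dx Y Yp) (smoothed_dy Y Yq).
Proof.
move=> oO HY HU.
have Hx := @has_C1_grad_fst R O; have Hy := @has_C1_grad_snd R O.
have Hb := has_C1_grad_comp1 Hx (fun z _ => conj (soft_abs_derive e z.1) (@dsoft_abs_continuous R e z.1)).
have HS := has_C1_grad_comp1 Hx (fun z _ => conj (soft_sgn_derive e z.1) (@dsoft_sgn_continuous R e z.1)).
have Hm := has_C1_grad_comp2 fC1 (has_C1_gradZ (- a) HY) Hb (fun z Oz => (HU z Oz).1).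
have Hp := has_C1_grad_comp2 fC1 (has_C1_gradZ a HY) Hb (fun z Oz => (HU z Oz).2).
have Hc := has_C1_gradD (has_C1_gradZ (e ^+ 2)^-1
   (has_C1_gradD (has_C1_gradM Hx Hx) (has_C1_gradM Hy Hy))) (has_C1_grad_cst (U := O) (-9)).
have Hcut := has_C1_grad_comp1 Hc (fun z _ => conj (smoothstep_derive _) (@dsmoothstep_continuous R _)).
have H := has_C1_gradZ k (has_C1_gradM Hcut (has_C1_gradD
  (has_C1_gradM (has_C1_gradZ a HS) Hm) (has_C1_gradZ (-1) Hp))).
have E z : (e ^+ 2)^-1 * (z.1 * z.1 + z.2 * z.2) + -9 = radius2 z / e ^+ 2 - 9.
  by rewrite /radius2 !expr2; ring.
apply: (eq_grad_C1_grad oO _ _ (eq_has_C1_grad oO _ H)) => z _ /=; rewrite E.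
- by rewrite /smoothed_dx /cutoff /dcutoff; ring.
- by rewrite /smoothed_dy /cutoff /dcutoff; ring.
- by rewrite /smoothed /cutoff; ring.
Qed.


(** The new ordinate solves Y^2 + b^2 = |z|^2 for the flattened abscissa b. As b <= |x|, the gap is
    at least y^2, so its square root is C^1 for y > 0. *)
Definition gap z := radius2 z - soft_abs e z.1 ^+ 2.
Definition height z := Num.sqrt (gap z).

Lemma continuous_radius2 : continuous radius2.
Proof.
move=> z; apply: cvgD; rewrite !expr2; apply: cvgM;
  (exact: continuous_fst_plane || exact: continuous_snd_plane).
Qed.

Lemma continuous_soft_abs_fst : continuous (fun z => soft_abs e z.1).
Proof.
move=> z; apply: (@continuous_comp _ _ _ fst (soft_abs e)); first exact: cvg_fst.
by apply/differentiable_continuous/derivable1_diffP; case: (soft_abs_derive e z.1).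
Qed.

Lemma continuous_height : continuous height.
Proof.
move=> z; apply: (@continuous_comp _ _ _ gap Num.sqrt); last exact: sqrt_continuous.
apply: cvgB; first exact: continuous_radius2.
by rewrite !expr2; apply: cvgM; exact: continuous_soft_abs_fst.
Qed.

Lemma gap_ge z : z.2 ^+ 2 <= gap z.
Proof.
rewrite /gap /radius2; have /andP[h1 h2] := soft_abs_bound e0 z.1.
suff : soft_abs e z.1 ^+ 2 <= z.1 ^+ 2 by lra.
by rewrite -[leRHS]real_normK ?num_real // lerXn2r ?nnegrE.
Qed.

Lemma gap_gt0 z : 0 < z.2 -> 0 < gap z.
Proof. by move=> h; apply: lt_le_trans (gap_ge z); rewrite exprn_gt0. Qed.

Lemma height_far z : 0 < z.2 -> 2 * e <= `|z.1| -> height z = z.2.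
Proof.
move=> z2 z1; rewrite /height /gap (soft_abs_far e0 z1).1 real_normK ?num_real //.
by rewrite /radius2 addrAC subrr add0r sqrtr_sqr gtr0_norm.
Qed.

Lemma height_C1 : has_C1_grad [set z | 0 < z.2] height
  (fun z => (z.1 - b z * db z) / height z) (fun z => z.2 / height z).
Proof.
have Hx := @has_C1_grad_fst R [set z | 0 < z.2].
have Hy := @has_C1_grad_snd R [set z | 0 < z.2].
have Hb := has_C1_grad_comp1 Hx (fun z _ => conj (soft_abs_derive e z.1) (@dsoft_abs_continuous R e z.1)).
have Hg := has_C1_gradD (has_C1_gradD (has_C1_gradM Hx Hx) (has_C1_gradM Hy Hy))
  (has_C1_gradZ (-1) (has_C1_gradM Hb Hb)).
have gE z : z.1 * z.1 + z.2 * z.2 + -1 * (b z * b z) = gap z.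
  by rewrite /gap /radius2 !expr2; ring.
have Hs := has_C1_grad_comp1 (phi := Num.sqrt) (dphi := fun t => (2 * Num.sqrt t)^-1) Hg.
have o2 : open [set z : R * R | 0 < z.2].
  by apply: (@open_comp _ _ (fun z : R * R => z.2) [set t | 0 < t]);
    [move=> z _; exact: continuous_snd_plane | exact: open_gt].
have hz z : 0 < z.2 -> height z != 0.
  by move=> z2; rewrite gt_eqF // sqrtr_gt0 gap_gt0.
have {}Hs := Hs _; apply: (eq_grad_C1_grad o2 _ _ (eq_has_C1_grad o2 _ (Hs _))).
- by move=> z z2; rewrite gE -/(height z); field; exact: hz.
- by move=> z z2; rewrite gE -/(height z); field; exact: hz.
- by move=> z _; rewrite gE.
- move=> z z2; rewrite gE; have g0 := gap_gt0 z2; split; first exact: is_derive1_sqrt.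
  apply: cvgV; first by rewrite mulf_neq0 //; exact: hz.
  by apply: cvgM; [exact: cvg_cst | exact: sqrt_continuous].
Qed.

Hypothesis clU : closure (@half_disk R) `<=` U.
Hypothesis ha : a = 1 \/ a = -1.

Lemma rotated_in_closure (c y : R) : 0 <= c -> y ^+ 2 + c ^+ 2 <= 1 ->
  U (- a * y, c) /\ U (a * y, c).
Proof.
move=> c0 h; have a2 : a ^+ 2 = 1 by case: ha => ->; rewrite ?sqrrN expr1n.
by split; apply: clU; apply/closure_half_diskP; split => //=;
  rewrite exprMn ?sqrrN a2 mul1r.
Qed.

(* For |x| > 2e the function [height] is |y|, which has a corner on the real
   axis; hence the second branch. *)
Definition smoothed_height z := if 0 < z.2 then height z else z.2.

(** Three open sets cover the closed half-disk. On [upper_part] the height is C^1; on [outer_part]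
    the smoothed height is y; on [inner_part] the cutoff makes the function 0. The preimages of [U]
    ensure that [f] is evaluated only where it is C^1. *)
Definition upper_part :=
  [set z | 0 < z.2] `&` ((fun z => (- a * height z, b z)) @^-1` U `&`
                         (fun z => (a * height z, b z)) @^-1` U).

Definition outer_part :=
  [set z | 2 * e < `|z.1|] `&` ((fun z => (- a * z.2, b z)) @^-1` U `&`
                         (fun z => (a * z.2, b z)) @^-1` U).

Definition inner_part := [set z | radius2 z < 9 * e ^+ 2].

Lemma continuous_rotated (c : R) (Y : R * R -> R) : continuous Y ->
  continuous (fun z => (c * Y z, b z)).
Proof.
move=> cY z; have c1 : {for z, continuous (fun z => c * Y z)}.
  by apply: cvgM; [exact: cvg_cst | exact: cY].
exact: (cvg_pair c1 (@continuous_soft_abs_fst z)).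
Qed.

Lemma open_upper_part : open upper_part.
Proof.
apply: openI.
  by apply: (@open_comp _ _ (fun z : R * R => z.2) [set t | 0 < t]);
    [move=> z _; exact: continuous_snd_plane | exact: open_gt].
by apply: openI; apply: open_comp => // z _; apply: continuous_rotated; exact: continuous_height.
Qed.

Lemma open_outer_part : open outer_part.
Proof.
apply: openI.
  apply: (@open_comp _ _ (fun z : R * R => `|z.1|) [set t | 2 * e < t]); last exact: open_gt.
  move=> z _; apply: (@continuous_comp _ _ _ fst (@Num.norm _ R)); first exact: cvg_fst.
  exact: norm_continuous.
by apply: openI; apply: open_comp => // z _; apply: continuous_rotated; exact: continuous_snd_plane.
Qed.

Lemma open_inner_part : open inner_part.
Proof.
apply: (@open_comp _ _ radius2 [set t | t < 9 * e ^+ 2]); last exact: open_lt.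
by move=> z _; exact: continuous_radius2.
Qed.

Lemma cutoff_inner z : radius2 z <= 9 * e ^+ 2 -> cutoff z = 0 /\ dcutoff z = 0.
Proof.
move=> h; have h0 : radius2 z / e ^+ 2 - 9 <= 0.
  by rewrite subr_le0 ler_pdivrMr // exprn_gt0.
by rewrite /cutoff /dcutoff smoothstep_le0 // dsmoothstep_le0 // mul0r.
Qed.

Lemma cutoff_outer z : 10 * e ^+ 2 <= radius2 z -> cutoff z = 1 /\ dcutoff z = 0.
Proof.
move=> h; have h0 : 1 <= radius2 z / e ^+ 2 - 9.
  have : 10 <= radius2 z / e ^+ 2 by rewrite ler_pdivlMr // exprn_gt0.
  by lra.
by rewrite /cutoff /dcutoff smoothstep_ge1 // dsmoothstep_ge1 // mul0r.
Qed.

Local Notation w := (smoothed smoothed_height).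

Lemma smoothed_upper : has_C1_grad upper_part w
  (smoothed_dx height (fun z => (z.1 - b z * db z) / height z))
  (smoothed_dy height (fun z => z.2 / height z)).
Proof.
have := smoothed_C1 open_upper_part (sub_has_C1_grad (@subIsetl _ _ _) height_C1).
move=> H; apply: (eq_has_C1_grad open_upper_part _ (H _)); last by move=> z [].
by move=> z [z2 _]; rewrite /smoothed /smoothed_height z2.
Qed.

Lemma smoothed_outer : C1_on outer_part w.
Proof.
have H := smoothed_C1 open_outer_part (@has_C1_grad_snd R _).
apply: (has_C1_grad_on open_outer_part); apply: (eq_has_C1_grad open_outer_part _ (H _)).
  move=> z [z1 _]; rewrite /smoothed /smoothed_height; case: ifP => // z2.
  by rewrite height_far // ltW.
by move=> z [_ []].
Qed.

Lemma smoothed_inner : C1_on inner_part w.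
Proof.
apply: (has_C1_grad_on open_inner_part).
apply: (eq_has_C1_grad open_inner_part _ (has_C1_grad_cst (0 : R))) => z hz.
by rewrite /smoothed (cutoff_inner (ltW hz)).1 mul0r mulr0.
Qed.

Lemma height_sq z : height z ^+ 2 + b z ^+ 2 = radius2 z.
Proof.
rewrite sqr_sqrtr; first by rewrite /gap subrK.
by apply: le_trans (gap_ge z); exact: sqr_ge0.
Qed.

Lemma half_disk_upper_part z : radius2 z <= 1 -> 0 < z.2 -> upper_part z.
Proof.
move=> z1 z2; have /andP[b0 _] := soft_abs_bound e0 z.1.
have hz : height z ^+ 2 + b z ^+ 2 <= 1 by rewrite height_sq.
by have [h1 h2] := rotated_in_closure b0 hz; split.
Qed.

Lemma smoothed_C1_closure : C1_closure (@half_disk R) w.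
Proof.
exists (upper_part `|` outer_part `|` inner_part); split.
- apply: openU; last exact: open_inner_part.
  by apply: openU; [exact: open_upper_part | exact: open_outer_part].
- move=> z /closure_half_diskP[z1 z2].
  have [z0|z0] := ltP 0 z.2; first by left; left; exact: half_disk_upper_part.
  have {z0}z0 : z.2 = 0 by apply/eqP; rewrite eq_le z0 z2.
  have [h|h] := ltP (2 * e) `|z.1|; [left; right | right].
    split => //; rewrite /preimage /= z0.
    apply: rotated_in_closure => //; first by have /andP[] := soft_abs_bound e0 z.1.
    rewrite (soft_abs_far e0 (ltW h)).1 real_normK ?num_real // addrC.
    by rewrite z0 in z1.
  rewrite /inner_part /= /radius2 z0 expr0n addr0 -real_normK ?num_real //.
  have : `|z.1| ^+ 2 <= (2 * e) ^+ 2 by rewrite lerXn2r ?nnegrE // mulr_ge0 // ltW.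
  have : 0 < e ^+ 2 by rewrite exprn_gt0.
  by rewrite exprMn; lra.
- move=> z [[Hz|/smoothed_outer //]|/smoothed_inner //].
  exact: (has_C1_grad_on open_upper_part smoothed_upper Hz).
Qed.


Local Notation D := (@half_disk R).
Definition height_dx z := (z.1 - soft_abs e z.1 * dsoft_abs e z.1) / height z.
Definition height_dy z := z.2 / height z.

Lemma smoothed_grad z : D z -> 
  grad w z = (smoothed_dx height height_dx z, smoothed_dy height height_dy z).
Proof.
move=> [z1 z2]; have Uz := half_disk_upper_part (ltW z1) z2.
by have [_ e1 e2 _ _] := smoothed_upper Uz; rewrite /grad e1 e2.
Qed.

(** For |x| >= 4e one has |z|^2 >= 16 e^2 >= 10 e^2, so cutoff, sign and flattening are all
    inactive. The smoothing error is thus confined to a strip. *)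
Lemma smoothed_far z : D z -> 4 * e <= `|z.1| ->
  w z = mix (- k) (a * k) (- a * k) (- k) f z /\
  grad w z = (mix (- k) (a * k) (a * k) k fq z, mix (- k) (- a * k) (- a * k) k fp z).
Proof.
move=> Dz z1; rewrite smoothed_grad //; have [_ z2] := Dz.
have e0' := e0; have he : e <= `|z.1| by lra.
have h2e : 2 * e <= `|z.1| by lra.
have r10 : 10 * e ^+ 2 <= radius2 z.
  have : (4 * e) ^+ 2 <= `|z.1| ^+ 2 by rewrite lerXn2r ?nnegrE // mulr_ge0 // ltW.
  rewrite real_normK ?num_real // exprMn /radius2.
  have := sqr_ge0 z.2; have : 0 < e ^+ 2 by rewrite exprn_gt0.
  by lra.
rewrite /smoothed /smoothed_dx /smoothed_dy /smoothed_height /height_dx /height_dy z2 height_far //.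
have [-> ->] := cutoff_outer r10; have [-> ->] := soft_sgn_far e0 he.
have [-> ->] := soft_abs_far e0 h2e.
have z20 : z.2 != 0 by rewrite gt_eqF.
have -> : z.1 - `|z.1| * Num.sg z.1 = 0 by rewrite mulrC -numEsg subrr.
rewrite divff // /mix; have [x0|x0|x0] := ltgtP z.1 0; last by move: he; rewrite x0 normr0 leNgt e0.
- rewrite ltr0_sg // ltr0_norm //.
  case: ha => ->; rewrite ?opprK ?mulN1r ?mul1r; split; [ring | congr pair; ring | ring | congr pair; ring].
- rewrite gtr0_sg // gtr0_norm //.
  case: ha => ->; rewrite ?opprK ?mulN1r ?mul1r; split; [ring | congr pair; ring | ring | congr pair; ring].
Qed.

(** On the new Dirichlet ray both terms evaluate [f] at the same point of the imaginary axis, with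
    opposite signs as a * sgn x = 1. Where |x| <= 2e the sign may be smoothed, but the cutoff is
    0. *)
Lemma smoothed_dirichlet_axis (x : R) : 0 < a * x -> w (x, 0) = 0.
Proof.
move=> ax; rewrite /smoothed /smoothed_height /= ltxx !mulr0.
have [h|h] := ltP (2 * e) `|x|; last first.
  rewrite (cutoff_inner _).1 ?mul0r ?mulr0 //.
  rewrite /radius2 /= expr0n addr0 -real_normK ?num_real //.
  have : `|x| ^+ 2 <= (2 * e) ^+ 2 by rewrite lerXn2r ?nnegrE // mulr_ge0 // ltW.
  have : 0 < e ^+ 2 by rewrite exprn_gt0.
  by rewrite exprMn; lra.
have e0' := e0; have he : e <= `|x| by lra.
have [-> _] := soft_sgn_far e0 he.
have -> : a * Num.sg x = 1.
  case: ha ax => ->; rewrite ?mul1r ?mulN1r; first by move/gtr0_sg.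
  by rewrite oppr_gt0 => /ltr0_sg ->; rewrite opprK.
by rewrite mul1r subrr !mulr0.
Qed.

(** As |z| is preserved, both terms evaluate [f] on the arc again, at the two points of ordinate c,
    the flattened |x|. Whether [f] vanishes there depends on the direction of transplantation and is
    left as a premise. *)
Lemma smoothed_dirichlet_arc z : z.1 ^+ 2 + z.2 ^+ 2 = 1 -> 0 < z.2 ->
  exists c, [/\ 0 <= c, c <= `|z.1|, 2 * e <= `|z.1| -> c = `|z.1| &
    (forall t, t = 1 \/ t = -1 -> f (t * Num.sqrt (1 - c ^+ 2), c) = 0) -> w z = 0].
Proof.
move=> z1 z2; exists (b z); have /andP[b0 b1] := soft_abs_bound e0 z.1.
split => // [h|H]; first by have [-> _] := soft_abs_far e0 h.
rewrite /smoothed /smoothed_height z2.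
have -> : height z = Num.sqrt (1 - b z ^+ 2) by rewrite /height /gap /radius2 z1.
rewrite !H; first by rewrite mulr0 subrr !mulr0.
- by case: ha => ->; [left | right].
- by case: ha => ->; [right | left]; rewrite ?opprK.
Qed.

(** * Bounds on the smoothed transplant, uniform in e *)

Variables (M L : R).
Hypothesis hk : `|k| <= 1.
Hypothesis fM : forall z, closure D z -> [/\ `|f z| <= M, `|fp z| <= M & `|fq z| <= M].
Hypothesis fL : forall z, closure D z -> radius2 z <= 10 * e ^+ 2 -> `|f z| <= L * e.
Hypothesis f0 : forall t, 0 < t < 1 -> f (- a * t, 0) = 0.

Lemma height_gt0 z : 0 < z.2 -> 0 < height z.
Proof. by move=> z2; rewrite sqrtr_gt0 gap_gt0. Qed.

Lemma a_sq : a ^+ 2 = 1.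
Proof. by case: ha => ->; rewrite ?sqrrN expr1n. Qed.

Lemma norm_a : `|a| <= 1.
Proof. by case: ha => ->; rewrite ?normrN normr1. Qed.

Lemma rotated_closure z : D z ->
  closure D (- a * height z, b z) /\ closure D (a * height z, b z).
Proof.
move=> [z1 z2]; have /andP[b0 _] := soft_abs_bound e0 z.1.
by split; apply/closure_half_diskP; split => //=;
  rewrite exprMn ?sqrrN a_sq mul1r height_sq ltW.
Qed.

Lemma rotated_radius2 z :
  radius2 (- a * height z, b z) = radius2 z /\ radius2 (a * height z, b z) = radius2 z.
Proof.
by rewrite /radius2 /= !exprMn ?sqrrN a_sq !mul1r height_sq.
Qed.

Lemma smoothed_bound z : D z -> `|w z| <= M + M.
Proof.
move=> Dz; have [_ z2] := Dz.
have [/fM[h1 _ _] /fM[h2 _ _]] := rotated_closure Dz.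
rewrite /smoothed /smoothed_height z2 -[leRHS]mul1r ler_normM //.
rewrite -[leRHS]mul1r ler_normM //.
  by rewrite ger0_norm ?smoothstep_ge0 // smoothstep_le1.
rewrite ler_normBD // -[leRHS]mul1r ler_normM //.
by rewrite -[leRHS]mul1r ler_normM //; [exact: norm_a | exact: soft_sgn_bound].
Qed.

Lemma cutoff_le1 z : `|cutoff z| <= 1.
Proof. by rewrite ger0_norm ?smoothstep_ge0 // smoothstep_le1. Qed.

(** The derivative of the cutoff is of order 1/e, but where it is not 0 the values of [f] are at
    most L e. The constant is 64 = 4 * 2 * 4 * 2: the bound on [dsmoothstep], the factor of
    [dcutoff], |t| <= 4e, and the two values of [f]. *)
Lemma dcutoff_term z t : D z -> t ^+ 2 <= radius2 z ->
  `|dcutoff z * t * (a * S z * f (- a * height z, b z) - f (a * height z, b z))| <= 64 * L.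
Proof.
move=> Dz tz; have [c1 c2] := rotated_closure Dz; have [r1 r2] := rotated_radius2 z.
have e2 : 0 < e ^+ 2 by rewrite exprn_gt0.
have L0 : 0 <= L * e.
  apply: (le_trans (normr_ge0 (f (0, 0)))); apply: fL.
    by apply/closure_half_diskP; rewrite /= expr0n addr0.
  by rewrite /radius2 /= expr0n addr0 mulr_ge0 // ltW.
have [h10|h10] := leP (10 * e ^+ 2) (radius2 z).
  by rewrite (cutoff_outer h10).2 !mul0r normr0 mulr_ge0 // -(pmulr_lge0 _ e0).
have F1 : `|f (- a * height z, b z)| <= L * e by apply: fL => //; rewrite r1 ltW.
have F2 : `|f (a * height z, b z)| <= L * e by apply: fL => //; rewrite r2 ltW.
have -> : 64 * L = (4 * (2 / e ^+ 2) * (4 * e)) * (L * e + L * e).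
  by field; rewrite gt_eqF.
apply: ler_normM; last first.
  rewrite ler_normBD // -[leRHS]mul1r ler_normM //.
  by rewrite -[leRHS]mul1r ler_normM //; [exact: norm_a | exact: soft_sgn_bound].
apply: ler_normM; last first.
  rewrite -ler_sqr ?nnegrE ?mulr_ge0 // ?(ltW e0) // real_normK ?num_real //.
  by rewrite exprMn; move: tz h10; lra.
rewrite /dcutoff; apply: ler_normM; last by rewrite ger0_norm // divr_ge0 // ltW.
rewrite ger0_norm ?dsmoothstep_ge0 //.
have [h|h] := leP 0 (radius2 z / e ^+ 2 - 9); first exact: dsmoothstep_le4.
by rewrite dsmoothstep_le0 // ltW.
Qed.

(* The factor [dS z] is of order 1/e, but where it does not vanish it multiplies
   a value of [f] on the Dirichlet segment. *)
Lemma dsoft_sgn_term z : D z -> dS z * f (- a * height z, b z) = 0.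
Proof.
move=> [z1 z2]; have [h|h] := leP e `|z.1|.
  by rewrite (soft_sgn_far e0 h).2 mul0r.
have [b0 _] := soft_abs_near e0 (ltW h).
rewrite b0 f0 ?mulr0 // height_gt0 //=.
have hr := height_sq z; rewrite b0 expr0n addr0 in hr.
by rewrite -(@expr_lt1 _ 2) ?hr //; exact: ltW (height_gt0 z2).
Qed.

(** For |x| >= 2e the derivative is 0, as b = |x|. Otherwise height^2 = |z|^2 - b^2 >= 9 e^2 - 4
    e^2, so the height is at least 2e, while the numerator is at most 2e + 2e * 9 = 20e. *)
Lemma height_dx_bound z : 0 < z.2 -> 9 * e ^+ 2 < radius2 z -> `|height_dx z| <= 10.
Proof.
move=> z2 hr; have h0 := height_gt0 z2.
have [h|h] := leP (2 * e) `|z.1|.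
  have [b1 b2] := soft_abs_far e0 h.
  by rewrite /height_dx b1 b2 [X in _ - X]mulrC -numEsg subrr mul0r normr0.
have /andP[b0 b1] := soft_abs_bound e0 z.1.
have h2e : 2 * e <= height z.
  rewrite -ler_sqr ?nnegrE ?mulr_ge0 // ?(ltW e0) // ?(ltW h0) //.
  have := height_sq z.
  have : b z ^+ 2 <= (2 * e) ^+ 2.
    rewrite lerXn2r ?nnegrE // ?mulr_ge0 // ?(ltW e0) //.
    exact: le_trans b1 (ltW h).
  by rewrite !exprMn; have := exprn_gt0 2 e0; move: hr; lra.
rewrite /height_dx normrM normfV (gtr0_norm h0) ler_pdivrMr //.
have : `|z.1 - b z * db z| <= 2 * e + 2 * e * 9.
  apply: ler_normBD; first exact: ltW.
  apply: ler_normM; last exact: dsoft_abs_bound.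
  by rewrite ger0_norm //; exact: le_trans b1 (ltW h).
by move: h2e; lra.
Qed.

Lemma height_dy_bound z : 0 < z.2 -> `|height_dy z| <= 1.
Proof.
move=> z2; have h0 := height_gt0 z2.
rewrite /height_dy normrM normfV !gtr0_norm // ler_pdivrMr // mul1r.
rewrite -ler_sqr ?nnegrE ?(ltW z2) ?(ltW h0) // sqr_sqrtr; first exact: gap_ge.
exact: ltW (gap_gt0 z2).
Qed.

Lemma smoothed_dx_bound z : D z -> `|smoothed_dx height height_dx z| <= 64 * L + 38 * M.
Proof.
move=> Dz; have [_ z2] := Dz.
have [/fM[h1 h2 h3] /fM[h4 h5 h6]] := rotated_closure Dz.
have M0 : 0 <= M := le_trans (normr_ge0 _) h1.
rewrite /smoothed_dx -[leRHS]mul1r ler_normM //.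
apply: ler_normDD.
  by apply: dcutoff_term => //; rewrite /radius2 lerDl sqr_ge0.
have [c0|c0] := leP (radius2 z) (9 * e ^+ 2).
  by rewrite (cutoff_inner c0).1 mul0r normr0 mulr_ge0.
have dx := height_dx_bound z2 c0; have dbb := dsoft_abs_bound e0 z.1.
have aS : `|a * S z| <= 1.
  by rewrite -[leRHS]mul1r ler_normM //; [exact: norm_a | exact: soft_sgn_bound].
rewrite -[leRHS]mul1r; apply: ler_normM; first exact: cutoff_le1.
rewrite -mulrA dsoft_sgn_term // mulr0 add0r.
(* Each of the two terms contributes 10 from the derivative of the height and 9 from that of
   [soft_abs]. *)
have -> : 38 * M = 1 * (M * (1 * 10) + M * 9) + (M * (1 * 10) + M * 9) by ring.
apply: ler_normBD.
  apply: ler_normM => //; apply: ler_normDD; apply: ler_normM => //.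
  by apply: ler_normM => //; rewrite normrN norm_a.
apply: ler_normDD; apply: ler_normM => //.
by apply: ler_normM => //; exact: norm_a.
Qed.

Lemma smoothed_dy_bound z : D z -> `|smoothed_dy height height_dy z| <= 64 * L + 38 * M.
Proof.
move=> Dz; have [_ z2] := Dz.
have [/fM[h1 h2 h3] /fM[h4 h5 h6]] := rotated_closure Dz.
have M0 : 0 <= M := le_trans (normr_ge0 _) h1.
rewrite /smoothed_dy -[leRHS]mul1r ler_normM //.
apply: ler_normDD.
  by apply: dcutoff_term => //; rewrite /radius2 lerDr sqr_ge0.
have dy := height_dy_bound z2.
have aS : `|a * S z| <= 1.
  by rewrite -[leRHS]mul1r ler_normM //; [exact: norm_a | exact: soft_sgn_bound].
rewrite -[leRHS]mul1r; apply: ler_normM; first exact: cutoff_le1.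
apply: (@le_trans _ _ (1 * (M * (1 * 1)) + M * (1 * 1))); last by move: M0; lra.
apply: ler_normBD.
  apply: ler_normM => //; apply: ler_normM => //.
  by apply: ler_normM => //; rewrite normrN norm_a.
apply: ler_normM => //.
by apply: ler_normM => //; exact: norm_a.
Qed.

End smoothed_transplant.

(** * H^1 approximation of transplants of smooth functions *)

Lemma measurable_dist2 d (T : measurableType d) (R : realType) (D : set T)
    (u v p p' q q' : T -> R) :
  measurable_fun D u -> measurable_fun D v -> measurable_fun D p ->
  measurable_fun D p' -> measurable_fun D q -> measurable_fun D q' ->
  measurable_fun D (fun z => (u z - v z) ^+ 2 +
    ((p z - p' z) * (p z - p' z) + (q z - q' z) * (q z - q' z))).
Proof.
move=> mu mv mp mp' mq mq'; apply: measurable_funD.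
  by apply: measurable_funX; exact: measurable_funB.
by apply: measurable_funD; apply: measurable_funM; exact: measurable_funB.
Qed.

Section transplant_approximation.
Context {R : realType}.
Implicit Types (f w : R * R -> R) (z : R * R).
Local Notation D := (@half_disk R).
Local Notation mu := (area R).

Let mD : measurable (D : set (plane R)) := measurable_half_disk.

Lemma measurable_strip (c : R) :
  measurable ([set z | D z /\ `|z.1| < c] : set (plane R)).
Proof.
apply: open_measurable_plane.
have -> : [set z | D z /\ `|z.1| < c] = D `&` (fun z => `|z.1|) @^-1` [set t | t < c] by [].
apply: openI; first exact: open_half_disk.
apply: open_comp; last exact: open_lt.
move=> z _; apply: (@continuous_comp _ _ _ fst (@Num.norm _ R)); first exact: cvg_fst.
exact: norm_continuous.
Qed.

Lemma area_strip (c : R) : 0 <= c ->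
  (mu ([set z | D z /\ (`|z.1| < c)%R] : set (plane R)) <= (2 * c)%:E)%E.
Proof.
move=> c0.
have mS := measurable_strip c.
have mR : measurable (`[- c, c]%classic `*` `[0, 1]%classic : set (plane R)).
  by apply: measurableX; exact: measurable_itv.
have E : mu (`[- c, c]%classic `*` `[0, 1]%classic) = (2 * c)%:E.
  rewrite area_rect; [|exact: measurable_itv|exact: measurable_itv].
  rewrite !lebesgue_measure_itv /= !lte_fin ltr01 oppr0 adde0 mule1.
  case: ltP => h; first by rewrite -EFinD; congr EFin; ring.
  by congr EFin; lra.
rewrite -E; apply: le_measure; rewrite ?inE //.
move=> z [[z1 z2] z3]; split; rewrite /= in_itv /=.
  by move: z3; rewrite -ler_norml; exact: ltW.
rewrite (ltW z2) /=; have ? := sqr_ge0 z.1; nra.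
Qed.

Lemma area_half_disk_fin : (mu D < +oo)%E.
Proof.
apply: (@le_lt_trans _ _ (2 * 1)%:E); last exact: ltry.
apply: le_trans (area_strip ler01); apply: le_measure; rewrite ?inE //.
  apply: open_measurable_plane.
  have -> : [set z : R * R | D z /\ `|z.1| < 1] = D; last exact: open_half_disk.
  apply/seteqP; split => [z []//|z [z1 z2]]; split => //.
  have ? := sqr_ge0 z.2; rewrite ltr_norml; apply/andP; nra.
move=> z [z1 z2]; split => //.
have ? : 0 < z.2 ^+ 2 by rewrite exprn_gt0.
by rewrite ltr_norml; apply/andP; split; nra.
Qed.

Lemma C1_closure_L2 f : C1_closure D f ->
  [/\ L2 D f, L2 D (fun z => (grad f z).1) & L2 D (fun z => (grad f z).2)].
Proof.
case=> U [oU DU /C1_on_has_grad fU].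
have L g : (forall z, U z -> {for z, continuous g}) -> L2 D g.
  move=> cg; have [M HM] := bounded_on_closure (fun z clz => cg z (DU z clz)).
  apply: (sqint_bounded mD (M := M) area_half_disk_fin).
    apply: continuous_measurable_plane => [|z Dz]; first exact: open_half_disk.
    by apply/cg/DU; exact: subset_closure.
  by move=> z Dz; apply: HM; exact: subset_closure.
split; apply: L => z /fU[df _ _ c1 c2] //.
exact: differentiable_continuous.
Qed.

Lemma lipschitz_at0 f : differentiable f (0, 0) ->
  exists C, 0 <= C /\ \forall z \near (0 : R * R), `|f z - f (0, 0)| <= C * `|z|.
Proof.
move=> df; have [K K0 HK] := linear_lipschitz (diff_continuous df).
exists (1 + K); split; first by rewrite addr_ge0 // ltW.
have /diff_locally/eqaddoP/(_ 1 ltr01) := df.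
apply: filterS => z; rewrite !fctE /= mul1r => H.
have -> : f z - f (0, 0) = (f (z + (0, 0)) - (f (0, 0) + 'd f (0, 0) z)) + 'd f (0, 0) z.
  have -> : z + (0, 0) = z by exact: addr0.
  by rewrite opprD addrA subrK.
by rewrite mulrDl mul1r ler_normDD.
Qed.

(** The origin is not a point of the open Dirichlet segment, but a limit of points (-a t, 0) where
    [f] is 0. *)
Lemma vanishing_at0 f (a : R) : a = 1 \/ a = -1 -> differentiable f (0, 0) ->
  (forall t, 0 < t < 1 -> f (- a * t, 0) = 0) -> f (0, 0) = 0.
Proof.
move=> ha df f0; have [C [C0 HC]] := lipschitz_at0 df.
apply/eqP; rewrite -normr_le0; apply/ler_addgt0Pr => e e0; rewrite add0r.
have /nbhs_ballP[r /= r0 Hr] := HC.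
pose t := Num.min (Num.min (r / 2) (1 / 2)) (e / (C + 1)).
have t0 : 0 < t by rewrite !lt_min !divr_gt0 // ltr_wpDl.
have tr : t <= r / 2 by rewrite !ge_min lexx.
have t1 : t <= 1 / 2 by rewrite !ge_min lexx orbT.
have te : t <= e / (C + 1) by rewrite !ge_min lexx !orbT.
have nat_ : `|- a * t| = t.
  by rewrite normrM normrN (gtr0_norm t0); case: ha => ->; rewrite ?normrN normr1 mul1r.
have /= := Hr (- a * t, 0).
rewrite f0; last by lra.
rewrite sub0r normrN => H.
have nz : `|(- a * t, 0) : R * R| = t by rewrite prod_normE /= nat_ normr0 max_l // ltW.
rewrite nz in H; apply: le_trans (H _) _.
  by split; rewrite /ball /= sub0r normrN ?normr0 // nat_; lra.
have : t * (C + 1) <= e by rewrite -ler_pdivlMr // ltr_wpDl.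
by nra.
Qed.


(* For z = (x, y) with x != 0 and s the sign of x this is
     k * (a * s * u(- a * y, |x|) - u(a * y, |x|)),
   with a = 1 from Problem I to Problem II and a = -1 backwards. *)
Definition transplant (a k : R) (u : R * R -> R) : R * R -> R :=
  mix (- k) (a * k) (- a * k) (- k) u.

Definition transplant_grad (a k : R) (g : R * R -> R * R) (z : R * R) : R * R :=
  (mix (- k) (a * k) (a * k) k (fun x => (g x).2) z,
   mix (- k) (- a * k) (- a * k) k (fun x => (g x).1) z).

Lemma integral_strip (h : R * R -> R) (c N : R) : 0 <= c -> 0 <= N ->
  @measurable_fun _ _ (plane R) R D h -> (forall z, D z -> 0 <= h z) ->
  (forall z, D z -> h z <= N) -> (forall z, D z -> c <= `|z.1| -> h z = 0) ->
  (\int[mu]_(z in D) (h z)%:E <= (2 * c * N)%:E)%E.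
Proof.
move=> c0 N0 mh h0 hN hc.
set S : set (plane R) := [set z | D z /\ `|z.1| < c].
have mS : measurable S := measurable_strip c.
have SD : S `<=` D by move=> z [].
apply: (@le_trans _ _ (\int[mu]_(z in D) (N * \1_S z)%:E)%E).
  apply: ge0_le_integral => //.
  - exact/measurable_EFinP.
  - by apply/measurable_EFinP; apply: measurable_funM.
  - move=> z Dz; rewrite lee_fin indicE.
    case: (boolP (z \in S)) => /= [_|]; first by rewrite mulr1 hN.
    rewrite notin_setE => nS; rewrite mulr0 hc // leNgt; apply/negP => zc.
    by apply: nS; split.
under eq_integral do rewrite EFinM.
rewrite ge0_integralZl //; last by apply/measurable_EFinP.
rewrite integral_indic // (setIidl SD) [X in (_ <= X)%E]EFinM muleC.
by apply: lee_pmul => //; exact: area_strip.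
Qed.

Lemma bound_combination (p q P Q : R) : `|p| <= P -> `|q| <= Q ->
  (p - q) ^+ 2 <= (P + Q) ^+ 2.
Proof.
move=> hp hq; have h := ler_normBD hp hq.
by rewrite -[leLHS]real_normK ?num_real // lerXn2r ?nnegrE // (le_trans _ h).
Qed.

Lemma mix_bound p q r s (h : R * R -> R) M : 0 <= M ->
  `|p| <= 1 -> `|q| <= 1 -> `|r| <= 1 -> `|s| <= 1 ->
  (forall z, closure D z -> `|h z| <= M) ->
  forall z, D z -> `|mix p q r s h z| <= M + M.
Proof.
move=> M0 p1 q1 r1 s1 hM z [z1 z2]; rewrite /mix.
have H (x y : R) : 0 < y -> x ^+ 2 + y ^+ 2 < 1 -> `|h (x, y)| <= M.
  by move=> y0 xy; apply/hM/closure_half_diskP; split; rewrite /= ltW.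
case: ifP => [x0|_]; last case: ifP => [x0|_].
- by rewrite ler_normDD // -[leRHS]mul1r ler_normM // H // ?sqrrN // addrC.
- by rewrite ler_normDD // -[leRHS]mul1r ler_normM // H // ?sqrrN 1?addrC // oppr_gt0.
- by rewrite normr0 addr_ge0.
Qed.

Lemma dist2_ge0 (x y : R) (g h : R * R) : 0 <= (x - y) ^+ 2 + dot (g - h) (g - h).
Proof. by rewrite /dot -!expr2 !addr_ge0 // sqr_ge0. Qed.

Lemma dist2_self (x : R) (g : R * R) : (x - x) ^+ 2 + dot (g - g) (g - g) = 0.
Proof. by rewrite !subrr /dot /= !mulr0 expr0n !addr0. Qed.

Lemma dist2_le (x y : R) (g h : R * R) (A B : R) : `|x| <= A -> `|y| <= A ->
  `|g.1| <= A -> `|g.2| <= A -> `|h.1| <= B -> `|h.2| <= B ->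
  (x - y) ^+ 2 + dot (g - h) (g - h) <= (A + A) ^+ 2 + (A + B) ^+ 2 + (A + B) ^+ 2.
Proof.
move=> hx hy h1 h2 h3 h4; rewrite /dot -!expr2 -addrA.
by apply: lerD; [|apply: lerD]; exact: bound_combination.
Qed.

(** The squared distance is bounded by a constant [N] independent of e and is 0 off the strip |x| <
    4e, so its integral is at most 8 e N. The parameter [delta] is the abscissa beyond which points
    of the arc must not be moved. *)
Lemma transplant_approx f (a k eps delta : R) : C1_closure D f ->
  a = 1 \/ a = -1 -> `|k| <= 1 -> (forall t, 0 < t < 1 -> f (- a * t, 0) = 0) ->
  0 < eps -> 0 < delta ->
  exists w, [/\ C1_closure D w, forall x, 0 < a * x -> w (x, 0) = 0,
    (forall z, z.1 ^+ 2 + z.2 ^+ 2 = 1 -> 0 < z.2 ->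
      exists c, [/\ 0 <= c, c <= `|z.1|, delta <= `|z.1| -> c = `|z.1| &
      (forall t, t = 1 \/ t = -1 -> f (t * Num.sqrt (1 - c ^+ 2), c) = 0) -> w z = 0]) &
    (\int[mu]_(z in D)
       ((transplant a k f z - w z) ^+ 2
        + dot (transplant_grad a k (grad f) z - grad w z)
              (transplant_grad a k (grad f) z - grad w z))%:E < eps%:E)%E].
Proof.
move=> Cf ha hk f0 eps0 delta0.
have [Lf Lf1 Lf2] := C1_closure_L2 Cf.
case: (Cf) => U [oU clU fC1]; have gf := C1_on_has_grad fC1.
have bnd (g : R * R -> R) : (forall z, U z -> {for z, continuous g}) ->
    exists M, 0 <= M /\ forall z, closure D z -> `|g z| <= M.
  move=> cg; have [M HM] := bounded_on_closure (fun z clz => cg z (clU z clz)).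
  exists M; split => //; apply: le_trans (normr_ge0 _) (HM (0, 0) _).
  by apply/closure_half_diskP; rewrite /= expr0n addr0.
have [M0 [M00 HM0]] : exists M, 0 <= M /\ forall z, closure D z -> `|f z| <= M.
  by apply: bnd => z /gf[df _ _ _ _]; exact: differentiable_continuous.
have [M1 [M10 HM1]] : exists M, 0 <= M /\ forall z, closure D z -> `|(grad f z).1| <= M.
  by apply: bnd => z /gf[].
have [M2 [M20 HM2]] : exists M, 0 <= M /\ forall z, closure D z -> `|(grad f z).2| <= M.
  by apply: bnd => z /gf[].
pose M := M0 + M1 + M2.
have Mge0 : 0 <= M by rewrite !addr_ge0.
have fM z : closure D z -> [/\ `|f z| <= M, `|(grad f z).1| <= M & `|(grad f z).2| <= M].
  by move=> cz; split; [apply: le_trans (HM0 z cz) _ | apply: le_trans (HM1 z cz) _ |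
    apply: le_trans (HM2 z cz) _]; rewrite /M; lra.
have U0 : U (0, 0) by apply/clU/closure_half_diskP; rewrite /= expr0n addr0.
have [df0 _ _ _ _] := gf _ U0.
have f00 := vanishing_at0 ha df0 f0.
have [C [C0 /nbhs_ballP[r /= r0 HC]]] := lipschitz_at0 df0.
(* The gradient bound with L = 4C: |f| <= C |z|, and |z| <= 4e wherever the cutoff varies. In [N],
   the values and the gradient of the transplant are bounded by 2M, the gradient of the approximant
   by [K]. *)
pose K := 64 * (4 * C) + 38 * M.
have K0 : 0 <= K by rewrite addr_ge0 // !mulr_ge0.
pose N := (2 * M + 2 * M) ^+ 2 + (2 * M + K) ^+ 2 + (2 * M + K) ^+ 2.
have N0 : 0 <= N by rewrite !addr_ge0 // sqr_ge0.
(* The three terms give 2e <= delta, put |z| <= 4e inside the ball where [f] is Lipschitz at 0, and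
   make 8 e N < eps. *)
pose e := Num.min (Num.min (delta / 2) (r / 8)) (eps / (16 * (N + 1))).
have e0 : 0 < e by rewrite !lt_min !divr_gt0 // mulr_gt0 // ltr_wpDl.
have ed : e <= delta / 2 by rewrite !ge_min lexx.
have er : e <= r / 8 by rewrite !ge_min lexx orbT.
have eeps : e <= eps / (16 * (N + 1)) by rewrite !ge_min lexx !orbT.
have fL z : closure D z -> radius2 z <= 10 * e ^+ 2 -> `|f z| <= (4 * C) * e.
  move=> _ rz.
  have nz : `|z| <= 4 * e.
    have e20 : 0 < e ^+ 2 by rewrite exprn_gt0.
    have s1 := sqr_ge0 z.1; have s2 := sqr_ge0 z.2; rewrite /radius2 in rz.
    by rewrite prod_normE ge_max; apply/andP; split;
      rewrite -ler_sqr ?nnegrE ?mulr_ge0 ?(ltW e0) // real_normK ?num_real // exprMn; lra.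
  have Bz : ball (0 : R * R) r z.
    rewrite -ball_normE /ball_ /= sub0r normrN; apply: le_lt_trans nz _.
    by move: er r0; lra.
  have := HC z Bz; rewrite /= f00 subr0 => H; apply: le_trans H _.
  by rewrite [4 * C]mulrC -mulrA ler_wpM2l.
pose w := smoothed a k e f (smoothed_height e).
have Cw : C1_closure D w := smoothed_C1_closure k e0 oU gf clU ha.
have [Lw Lw1 Lw2] := C1_closure_L2 Cw.
exists w; split => //.
- by move=> x ax; exact: smoothed_dirichlet_axis.
- move=> z z1 z2; have [c [c0 c1 c2 c3]] := smoothed_dirichlet_arc k f e0 ha z1 z2.
  by exists c; split => // dz; apply: c2; move: ed dz; lra.
have ak1 : `|a * k| <= 1 by rewrite -[leRHS]mul1r ler_normM // norm_a.
have ak2 : `|- a * k| <= 1 by rewrite mulNr normrN.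
have k2 : `|- k| <= 1 by rewrite normrN.
have e40 : 0 <= 4 * e by rewrite mulr_ge0 // ltW.
apply: (@le_lt_trans _ _ (2 * (4 * e) * N)%:E); last first.
  rewrite lte_fin.
  have : e * (16 * (N + 1)) <= eps by rewrite -ler_pdivlMr // mulr_gt0 // ltr_wpDl.
  have : 0 <= e * N by rewrite mulr_ge0 // ltW.
  by move: e0 eps0; lra.
have mg1 : L2 D (fun z => (transplant_grad a k (grad f) z).1) by exact: L2_mix.
have mg2 : L2 D (fun z => (transplant_grad a k (grad f) z).2) by exact: L2_mix.
have mT : L2 D (transplant a k f) by exact: L2_mix.
apply: integral_strip => //.
- exact: (measurable_dist2 mT.1 Lw.1 mg1.1 Lw1.1 mg2.1 Lw2.1).
- by move=> z _; exact: dist2_ge0.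
- have mb p q t s h : `|p| <= 1 -> `|q| <= 1 -> `|t| <= 1 -> `|s| <= 1 ->
    (forall z, closure D z -> `|h z| <= M) ->
    forall z, D z -> `|mix p q t s h z| <= 2 * M.
    by move=> *; rewrite mulr_natl mulr2n; exact: mix_bound.
  move=> z Dz; apply: dist2_le.
  + by apply: mb => // x /fM[].
  + by rewrite mulr_natl mulr2n; exact: (smoothed_bound e0 ha hk fM Dz).
  + by apply: mb => // x /fM[].
  + by apply: mb => // x /fM[].
  + rewrite (smoothed_grad k e0 oU gf clU ha Dz).
    exact: (smoothed_dx_bound e0 ha hk fM fL f0 Dz).
  + rewrite (smoothed_grad k e0 oU gf clU ha Dz).
    exact: (smoothed_dy_bound e0 ha hk fM fL Dz).
- move=> z Dz hz; have [w1 w2] := smoothed_far k e0 oU gf clU ha Dz hz.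
  have -> : w z = transplant a k f z := w1.
  have -> : grad w z = transplant_grad a k (grad f) z := w2.
  exact: dist2_self.
Qed.

End transplant_approximation.

(** * Integration by parts and weak gradients of H^1 limits *)

Section weak_gradients.
Context {R : realType}.
Implicit Types (f u v w : R * R -> R) (z : R * R).
Local Notation D := (@half_disk R).
Local Notation mu := (area R).

Let mD : measurable (D : set (plane R)) := measurable_half_disk.

Lemma integral_derivative_compact (g p : R -> R) :
  (forall x : R, is_derive x 1 g (p x)) -> continuous p ->
  (forall x, 1 <= `|x| -> g x = 0) -> (forall x, 1 <= `|x| -> p x = 0) ->
  (\int[lebesgue_measure]_x (p x)%:E = 0)%E.
Proof.
move=> dg cp g0 p0.
have -> : (\int[lebesgue_measure]_x (p x)%:E =
           \int[lebesgue_measure]_(x in `[(-2)%R, 2%R]) (p x)%:E)%E.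
  rewrite [RHS]integral_mkcond; apply: eq_integral => x _.
  rewrite patchE; case: ifPn => //; rewrite notin_setE /= in_itv /= => /negP h.
  rewrite p0 //; rewrite leNgt; apply/negP; rewrite ltr_norml => /andP[h1 h2].
  by move/negP: h; apply; apply/andP; split; lra.
have cg : continuous g.
  by move=> x; apply/differentiable_continuous/derivable1_diffP; case: (dg x).
rewrite (@continuous_FTC2 _ p g).
- by rewrite !g0 ?subee //; rewrite ?normrN ger0_norm //; lra.
- by lra.
- by apply: continuous_subspaceT; exact: cp.
- split => [x _||]; first by case: (dg x).
  + by apply: cvg_at_right_filter; exact: cg.
  + by apply: cvg_at_left_filter; exact: cg.
- by move=> x _; rewrite derive1E; case: (dg x).
Qed.

Lemma is_derive_line1 f z p q : has_C1_grad setT f p q ->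
  is_derive z.1 1 (fun x => f (x, z.2)) (p z).
Proof.
move=> /(_ z I)[df e1 _ _ _].
have E : (fun h : R => h^-1 *: (((fun x => f (x, z.2)) \o shift z.1) (h *: 1) - f (z.1, z.2)))
   = (fun h : R => h^-1 *: ((f \o shift z) (h *: ((1, 0) : R * R)) - f z)).
  apply/funext => h; rewrite /= -surjective_pairing; congr (_ *: (f _ - _)).
  rewrite [RHS]surjective_pairing; congr pair; rewrite /= /GRing.scale /= ?mulr0 ?add0r //.
have dd := @diff_derivable _ _ _ _ _ ((1, 0) : R * R) df.
split; first by rewrite /derivable E; exact: dd.
by rewrite /derive E -e1.
Qed.

Lemma is_derive_line2 f z p q : has_C1_grad setT f p q ->
  is_derive z.2 1 (fun y => f (z.1, y)) (q z).
Proof.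
move=> /(_ z I)[df _ e2 _ _].
have E : (fun h : R => h^-1 *: (((fun y => f (z.1, y)) \o shift z.2) (h *: 1) - f (z.1, z.2)))
   = (fun h : R => h^-1 *: ((f \o shift z) (h *: ((0, 1) : R * R)) - f z)).
  apply/funext => h; rewrite /= -surjective_pairing; congr (_ *: (f _ - _)).
  rewrite [RHS]surjective_pairing; congr pair; rewrite /= /GRing.scale /= ?mulr0 ?add0r //.
have dd := @diff_derivable _ _ _ _ _ ((0, 1) : R * R) df.
split; first by rewrite /derivable E; exact: dd.
by rewrite /derive E -e2.
Qed.

Lemma half_disk_norm z : D z -> `|z.1| < 1 /\ `|z.2| < 1.
Proof.
move=> [z1 z2]; have s1 := sqr_ge0 z.1; have s2 := sqr_ge0 z.2.
by split; rewrite ltr_norml; apply/andP; split; nra.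
Qed.

(** After extension by 0 to the plane, Fubini allows each partial derivative to be integrated along
    its own variable first, where the fundamental theorem of calculus gives 0. *)
Lemma integral_gradient0 f p q : has_C1_grad setT f p q ->
  (forall z, ~ D z -> f z = 0) -> (forall z, ~ D z -> p z = 0) ->
  (forall z, ~ D z -> q z = 0) -> L2 D p -> L2 D q ->
  \int[mu]_(z in D) p z = 0 /\ \int[mu]_(z in D) q z = 0.
Proof.
move=> fC1 f0 p0 q0 Lp Lq.
have L1 : L2 D (fun=> 1).
  by apply: (sqint_bounded mD (M := 1) area_half_disk_fin) => // z _; rewrite normr1.
have out (x y : R) : 1 <= `|x| \/ 1 <= `|y| -> ~ D (x, y).
  by move=> h /half_disk_norm /= [h1 h2]; case: h; rewrite leNgt ?h1 ?h2.
have ext h : (forall z, ~ D z -> h z = 0) -> L2 D h ->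
    mu.-integrable setT (EFin \o h) /\
    (\int[mu]_(z in D) (h z)%:E = \int[mu]_z (h z)%:E)%E.
  move=> h0 Lh.
  have hi : mu.-integrable D (EFin \o h).
    have := sqintM mD Lh L1; apply: eq_integrable => // z _.
    by rewrite /= mulr1.
  have E : (EFin \o h) \_ D = EFin \o h.
    apply/funext => z; rewrite patchE; case: ifPn => //.
    by rewrite notin_setE => /h0 /= ->.
  split; first by rewrite -E; apply/(integrable_mkcond _ mD).
  rewrite integral_mkcond; apply: eq_integral => z _.
  by have := congr1 (fun k => k z) E.
have [pi pe] := ext p p0 Lp; have [qi qe] := ext q q0 Lq.
rewrite /Rintegral pe qe; split.
  rewrite -(integral21_prod_meas1 pi) integral0_eq // => y _.
  apply: (@integral_derivative_compact (fun x => f (x, y)) (fun x => p (x, y))).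
  - by move=> x; exact: (is_derive_line1 (x, y) fC1).
  - move=> x; apply: (@continuous_comp _ _ _ (fun x => (x, y)) p).
      exact: (cvg_pair cvg_id (cvg_cst y)).
    by have [] := fC1 (x, y) I.
  - by move=> x hx; apply/f0/out; left.
  - by move=> x hx; apply/p0/out; left.
rewrite -(integral12_prod_meas1 qi) integral0_eq // => x _.
apply: (@integral_derivative_compact (fun y => f (x, y)) (fun y => q (x, y))).
- by move=> y; exact: (is_derive_line2 (x, y) fC1).
- move=> y; apply: (@continuous_comp _ _ _ (fun y => (x, y)) q).
    exact: (cvg_pair (cvg_cst x) cvg_id).
  by have [] := fC1 (x, y) I.
- by move=> y hy; apply/f0/out; right.
- by move=> y hy; apply/q0/out; right.
Qed.


Lemma L2_continuous g : (forall z, {for z, continuous g}) -> L2 D g.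
Proof.
move=> cg; have [M HM] := bounded_on_closure (fun z _ => cg z).
apply: (sqint_bounded mD (M := M) area_half_disk_fin).
  by apply: continuous_measurable_plane => [|z Dz]; [exact: open_half_disk | exact: cg].
by move=> z Dz; apply: HM; exact: subset_closure.
Qed.

Lemma test_functionP f : test_function D f ->
  [/\ has_C1_grad setT f (fun z => (grad f z).1) (fun z => (grad f z).2),
      exists K, [/\ closed K, K `<=` D, forall z, ~ K z -> f z = 0 &
        forall z, ~ K z -> grad f z = (0, 0)] & C1_closure D f].
Proof.
case=> fC1 [K [cK KD f0]]; split; first exact: C1_on_has_grad.
- have clK : closed K by apply: compact_closed => //; exact: norm_hausdorff.
  exists K; split => // z Kz.
  have oK : open (~` K) by exact: closed_openC.
  have n0 : {near z, f =1 cst 0}.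
    have : nbhs z (~` K) by exact: open_nbhs_nbhs.
    by apply: filterS => x /f0.
  by rewrite (near_grad_eq n0) /grad !derive_cst.
- by exists setT; split => //; exact: openT.
Qed.

(** Although [f] is C^1 only near the closed half-disk, its product with a test function is C^1 on
    the plane, being 0 off a compact subset; the integral of its gradient vanishes. *)
Lemma integration_by_parts f v : C1_closure D f -> test_function D v ->
  (\int[mu]_(z in D) (f z * (grad v z).1) = - (\int[mu]_(z in D) ((grad f z).1 * v z))) /\
  (\int[mu]_(z in D) (f z * (grad v z).2) = - (\int[mu]_(z in D) ((grad f z).2 * v z))).
Proof.
move=> Cf Tv; have [vC1 [K [clK KD v0 dv0]] Cv] := test_functionP Tv.
have [Lf Lf1 Lf2] := C1_closure_L2 Cf; have [Lv Lv1 Lv2] := C1_closure_L2 Cv.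
have [U [oU clU fC1]] := Cf; have {}fC1 := C1_on_has_grad fC1.
have KU : K `<=` U by move=> z /KD Dz; apply/clU; exact: subset_closure.
pose p z := (grad f z).1 * v z + f z * (grad v z).1.
pose q z := (grad f z).2 * v z + f z * (grad v z).2.
have nK z : ~ K z -> [/\ f z * v z = 0, p z = 0 & q z = 0].
  by move=> Kz; rewrite /p /q v0 // dv0 //= !mulr0 addr0.
have C : has_C1_grad setT (fun z => f z * v z) p q.
  move=> z _; have [Uz|nUz] := pselect (U z).
    exact: (has_C1_gradM fC1 (sub_has_C1_grad (@subsetT _ _) vC1) Uz).
  have oK : open (~` K) by exact: closed_openC.
  have nKz : (~` K) z by move=> /KU.
  have H : has_C1_grad (~` K) (fun z => f z * v z) p q.
    apply: (eq_grad_C1_grad oK _ _ (eq_has_C1_grad oK _ (has_C1_grad_cst (0 : R)))).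
    - by move=> x /nK[].
    - by move=> x /nK[].
    - by move=> x /nK[].
  exact: H.
have nD z : ~ D z -> ~ K z by move=> Dz /KD.
have I1 h g : L2 D h -> L2 D g -> mu.-integrable D (EFin \o (fun z => h z * g z)).
  exact: sqintM.
have Lp : L2 D p.
  apply: L2_continuous => z.
  by have [_ _ _ cp _] := C z I; exact: cp.
have Lq : L2 D q.
  apply: L2_continuous => z.
  by have [_ _ _ _ cq] := C z I; exact: cq.
have [] := integral_gradient0 C _ _ _ Lp Lq.
- by move=> z /nD/nK[].
- by move=> z /nD/nK[].
- by move=> z /nD/nK[].
rewrite /p /q !RintegralD //; try exact: I1.
have oppE (x y : R) : x + y = 0 -> y = - x by move=> e; apply/eqP; rewrite -addr_eq0 addrC e.
by move=> e1 e2; split; [exact: (oppE _ _ e1) | exact: (oppE _ _ e2)].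
Qed.

(** The square of the H^1 norm, split by components because each is transplanted with its own
    orthogonal matrix. *)
Definition energy u (g : R * R -> R * R) : R :=
  \int[mu]_(z in D) (u z * u z) + \int[mu]_(z in D) ((g z).1 * (g z).1)
  + \int[mu]_(z in D) ((g z).2 * (g z).2).

Definition L2_pair u (g : R * R -> R * R) :=
  [/\ L2 D u, L2 D (fun z => (g z).1) & L2 D (fun z => (g z).2)].

Lemma L2_pairB u v g h : L2_pair u g -> L2_pair v h ->
  L2_pair (fun z => u z - v z) (fun z => g z - h z).
Proof. by move=> [u0 u1 u2] [v0 v1 v2]; split; exact: (sqintB mD). Qed.

Lemma integral_energy u g : L2_pair u g ->
  (\int[mu]_(z in D) ((u z) ^+ 2 + dot (g z) (g z))%:E = (energy u g)%:E)%E.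
Proof.
move=> [L0 L1 L2'].
have i0 := sqintM mD L0 L0; have i1 := sqintM mD L1 L1; have i2 := sqintM mD L2' L2'.
have i12 : mu.-integrable D (EFin \o (fun z => (g z).1 * (g z).1 + (g z).2 * (g z).2)).
  exact: (integrableD mD i1 i2).
rewrite /energy -addrA -RintegralD // -RintegralD //.
rewrite /Rintegral fineK; last first.
  by apply: (integrable_fin_num mD); exact: (integrableD mD i0 i12).
by apply: eq_integral => z _; rewrite expr2.
Qed.

Lemma Rintegral_sqr_ge0 u : 0 <= \int[mu]_(z in D) (u z * u z).
Proof. by apply: Rintegral_ge0 => z _; rewrite -expr2 sqr_ge0. Qed.

Lemma energy_ge u g : [/\ \int[mu]_(z in D) (u z * u z) <= energy u g,
  \int[mu]_(z in D) ((g z).1 * (g z).1) <= energy u g &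
  \int[mu]_(z in D) ((g z).2 * (g z).2) <= energy u g].
Proof.
have h0 := Rintegral_sqr_ge0 u; have h1 := Rintegral_sqr_ge0 (fun z => (g z).1).
have h2 := Rintegral_sqr_ge0 (fun z => (g z).2).
by rewrite /energy; split; lra.
Qed.

Lemma Rintegral_sqrD u v : L2 D u -> L2 D v ->
  \int[mu]_(z in D) ((u z + v z) * (u z + v z)) <=
  2 * (\int[mu]_(z in D) (u z * u z)) + 2 * (\int[mu]_(z in D) (v z * v z)).
Proof.
move=> Lu Lv; have iu := sqintM mD Lu Lu; have iv := sqintM mD Lv Lv.
have Ls := sqintD mD Lu Lv; have ss := sqintM mD Ls Ls.
have iu2 : mu.-integrable D (EFin \o (fun z => 2 * (u z * u z))) by exact: (integrableZl mD 2 iu).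
have iv2 : mu.-integrable D (EFin \o (fun z => 2 * (v z * v z))) by exact: (integrableZl mD 2 iv).
rewrite -!RintegralZl // -RintegralD //; apply: le_Rintegral => //.
  exact: (integrableD mD iu2 iv2).
by move=> z _; have := sqr_ge0 (u z - v z); rewrite expr2; nra.
Qed.

Lemma energyD u v g h : L2_pair u g -> L2_pair v h ->
  energy (fun z => u z + v z) (fun z => g z + h z) <= 2 * energy u g + 2 * energy v h.
Proof.
move=> [u0 u1 u2] [v0 v1 v2].
have h0 := Rintegral_sqrD u0 v0; have h1 := Rintegral_sqrD u1 v1.
have h2 := Rintegral_sqrD u2 v2; rewrite /energy /=; lra.
Qed.

(** A parametric substitute for the Cauchy-Schwarz inequality: with [eta] comparable to the norm of
    [u] it makes the pairing small, and only squared norms appear. *)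
Lemma norm_integralM u v (eta : R) : 0 < eta -> L2 D u -> L2 D v ->
  `|\int[mu]_(z in D) (u z * v z)| <=
  eta^-1 * (\int[mu]_(z in D) (u z * u z)) + eta * (\int[mu]_(z in D) (v z * v z)).
Proof.
move=> eta0 Lu Lv; have iu := sqintM mD Lu Lu; have iv := sqintM mD Lv Lv.
have iuv := sqintM mD Lu Lv.
have iu2 : mu.-integrable D (EFin \o (fun z => eta^-1 * (u z * u z))) by exact: (integrableZl mD _ iu).
have iv2 : mu.-integrable D (EFin \o (fun z => eta * (v z * v z))) by exact: (integrableZl mD _ iv).
apply: le_trans (le_normr_Rintegral mD iuv) _.
rewrite -!RintegralZl // -RintegralD //; apply: le_Rintegral => //.
- exact: (integrable_norm iuv).
- exact: (integrableD mD iu2 iv2).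
move=> z _ /=; set x := u z; set y := v z.
have -> : eta^-1 * (x * x) + eta * (y * y) =
    eta^-1 * ((x ^+ 2 + (eta * y) ^+ 2)) by field; rewrite gt_eqF.
rewrite -(ler_pM2l eta0) mulrA divff ?gt_eqF // mul1r.
have -> : eta * `|x * y| = `|x| * `|eta * y|.
  by rewrite !normrM (gtr0_norm eta0); ring.
have := sqr_ge0 (`|x| - `|eta * y|).
rewrite -(real_normK (num_real x)) -(real_normK (num_real (eta * y))).
have := normr_ge0 x; have := normr_ge0 (eta * y).
move: `|x| `|eta * y| => X Y; rewrite !expr2; nra.
Qed.

Lemma weak_gradient_limit u (g : R * R -> R * R) : L2_pair u g ->
  (forall e : R, 0 < e -> exists f, C1_closure D f /\
    energy (fun z => u z - f z) (fun z => g z - grad f z) < e) ->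
  weak_gradient D u g.
Proof.
move=> Lug H v Tv; have [_ _ Cv] := test_functionP Tv.
have [Lu Lg1 Lg2] := Lug; have [Lv Lv1 Lv2] := C1_closure_L2 Cv.
have main (k p pv : R * R -> R) : L2 D p -> L2 D pv ->
    (forall f, C1_closure D f -> exists q, [/\ L2 D q,
      \int[mu]_(z in D) (f z * pv z) = - (\int[mu]_(z in D) (q z * v z)) &
      \int[mu]_(z in D) ((p z - q z) * (p z - q z)) <=
        energy (fun z => u z - f z) (fun z => g z - grad f z)]) ->
    \int[mu]_(z in D) (u z * pv z) = - (\int[mu]_(z in D) (p z * v z)).
  move=> Lp Lpv ap; apply/eqP; rewrite -addr_eq0 -normr_le0.
  (* With an approximation error below eta^2, each of the two terms eta^-1 * eta^2 contributes at
     most [eta]; this is the 2 in [B]. The total is then eta * B = e. *)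
  set B := \int[mu]_(z in D) (pv z * pv z) + \int[mu]_(z in D) (v z * v z) + 2.
  have B0 : 0 < B by rewrite ltr_wpDl // addr_ge0 // Rintegral_sqr_ge0.
  apply/ler_addgt0Pr => e e0; rewrite add0r.
  pose eta := e / B; have eta0 : 0 < eta by rewrite divr_gt0.
  have [|f [Cf fe]] := H (eta ^+ 2); first by rewrite exprn_gt0.
  have [q [Lq ibp qe]] := ap f Cf; have [Lf _ _] := C1_closure_L2 Cf.
  have [ue _ _] := energy_ge (fun z => u z - f z) (fun z => g z - grad f z).
  have Luf := sqintB mD Lu Lf; have Lpq := sqintB mD Lp Lq.
  have -> : \int[mu]_(z in D) (u z * pv z) + \int[mu]_(z in D) (p z * v z) =
     \int[mu]_(z in D) ((u z - f z) * pv z) + \int[mu]_(z in D) ((p z - q z) * v z).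
    under [X in _ = X + _]eq_Rintegral do rewrite mulrBl.
    under [X in _ = _ + X]eq_Rintegral do rewrite mulrBl.
    rewrite !RintegralB //; try exact: sqintM.
    by rewrite ibp; ring.
  have N1 := norm_integralM eta0 Luf Lpv; have N2 := norm_integralM eta0 Lpq Lv.
  apply: le_trans (ler_normD _ _) _.
  have eE : e = eta * B by rewrite /eta divfK // gt_eqF.
  have bd (x : R) : x <= energy (fun z => u z - f z) (fun z => g z - grad f z) ->
      eta^-1 * x <= eta.
    move=> hx; rewrite ler_pdivrMl // -expr2; apply: le_trans hx (ltW fe).
  have := bd _ ue; have := bd _ qe; rewrite eE /B; lra.
split; [apply: (main (fun z => (g z).1)) | apply: (main (fun z => (g z).2))] => //.
- move=> f Cf; have [_ Lf1 _] := C1_closure_L2 Cf.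
  exists (fun z => (grad f z).1); split => //; first by have [] := integration_by_parts Cf Tv.
  by have [_ + _] := energy_ge (fun z => u z - f z) (fun z => g z - grad f z).
- move=> f Cf; have [_ _ Lf2] := C1_closure_L2 Cf.
  exists (fun z => (grad f z).2); split => //; first by have [] := integration_by_parts Cf Tv.
  by have [_ _ +] := energy_ge (fun z => u z - f z) (fun z => g z - grad f z).
Qed.

End weak_gradients.

(** * The boundary arcs in Cartesian coordinates *)

Section boundary_arcs.
Context {R : realType}.
Implicit Types (x y s t : R).

Lemma cos_double_gt0 s : `|s| <= pi / 2 ->
  (0 < cos (s *+ 2)) = (`|s| < pi / 4) /\ (cos (s *+ 2) < 0) = (pi / 4 < `|s|).
Proof.
move=> hs; have p0 := pi_gt0 R.
have E : cos (s *+ 2) = cos (`|s| *+ 2).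
  by have [_|_] := ler0P s; rewrite ?mulNrn ?cosN.
have h : `|s| *+ 2 \in `[(0 : R), pi] by rewrite in_itv /= mulr2n; have := normr_ge0 s; lra.
have h2 : pi / 2 \in `[(0 : R), pi] by rewrite in_itv /=; lra.
have E2 : `|s| *+ 2 = 2 * `|s| by rewrite mulr_natl.
have e1 : (0 < cos (`|s| *+ 2)) = (`|s| *+ 2 < pi / 2) by rewrite -(cos_pihalf R) ltr_cos.
have e2 : (cos (`|s| *+ 2) < 0) = (pi / 2 < `|s| *+ 2) by rewrite -(cos_pihalf R) ltr_cos.
by rewrite E e1 e2 E2; split; apply/idP/idP => ?; lra.
Qed.

Definition middle_arc : set (R * R) :=
  [set (cos t, sin t) | t in [set t : R | `|t - pi / 2| < pi / 4]].
Definition outer_arc : set (R * R) :=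
  [set (cos t, sin t) | t in [set t : R | pi / 4 < `|t - pi / 2| < pi / 2]].

Lemma unit_circle_angle x y : x ^+ 2 + y ^+ 2 = 1 -> 0 < y ->
  exists t, [/\ `|t - pi / 2| < pi / 2, cos t = x & sin t = y].
Proof.
move=> xy y0; have y20 := exprn_gt0 2 y0.
have x1 : -1 < x < 1 by apply/andP; split; nra.
have x1' : -1 <= x <= 1 by have /andP[h1 h2] := x1; rewrite !ltW.
exists (acos x); split.
- have /andP[h1 h2] := x1.
  have a0 : 0 < acos x by apply: acos_gt0; rewrite ltW.
  have a1 : acos x < pi by apply: acos_ltpi; rewrite h1 ltW.
  by rewrite ltr_norml; apply/andP; split; lra.
- by rewrite acosK.
- by rewrite sin_acos // -xy addrAC subrr add0r sqrtr_sqr gtr0_norm.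
Qed.

Lemma sq_diff_arc t : sin t ^+ 2 - cos t ^+ 2 = cos ((t - pi / 2) *+ 2).
Proof.
rewrite cos_mulr2n -[in LHS](subrK (pi / 2) t) sinDpihalf cosDpihalf sqrrN.
by have := cos2Dsin2 (t - pi / 2); rewrite mulr2n; lra.
Qed.

Lemma arc_coordinates t : `|t - pi / 2| < pi / 2 ->
  [/\ cos t ^+ 2 + sin t ^+ 2 = 1, 0 < sin t,
      (cos t ^+ 2 < sin t ^+ 2) = (`|t - pi / 2| < pi / 4) &
      (sin t ^+ 2 < cos t ^+ 2) = (pi / 4 < `|t - pi / 2|)].
Proof.
move=> ht; have [e1 e2] := cos_double_gt0 (ltW ht).
split.
- exact: cos2Dsin2.
- by move: ht; rewrite ltr_norml => /andP[h1 h2]; apply: sin_gt0_pi; apply/andP; split; lra.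
- by rewrite -e1 -sq_diff_arc subr_gt0.
- by rewrite -e2 -sq_diff_arc subr_lt0.
Qed.

(** In this form the exchange of |x| and y visibly swaps the two arcs: they differ only in which of
    x^2 and y^2 is larger. *)
Lemma middle_arcP x y : middle_arc (x, y) <->
  [/\ x ^+ 2 + y ^+ 2 = 1, 0 < y & x ^+ 2 < y ^+ 2].
Proof.
have p0 := pi_gt0 R; split=> [[t /= ht [<- <-]]|[h1 h2 h3]].
  have ht' : `|t - pi / 2| < pi / 2 by lra.
  by have [c1 c2 -> _] := arc_coordinates ht'.
have [t [ht tx ty]] := unit_circle_angle h1 h2.
exists t => /=; last by rewrite tx ty.
by have [_ _ <- _] := arc_coordinates ht; rewrite tx ty.
Qed.

Lemma outer_arcP x y : outer_arc (x, y) <->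
  [/\ x ^+ 2 + y ^+ 2 = 1, 0 < y & y ^+ 2 < x ^+ 2].
Proof.
have p0 := pi_gt0 R; split=> [[t /= /andP[ht1 ht2] [<- <-]]|[h1 h2 h3]].
  by have [c1 c2 _ ->] := arc_coordinates ht2.
have [t [ht tx ty]] := unit_circle_angle h1 h2.
exists t => /=; last by rewrite tx ty.
by rewrite ht andbT; have [_ _ _ <-] := arc_coordinates ht; rewrite tx ty.
Qed.

End boundary_arcs.

Lemma ltr_double_quarter (R : realType) (x y e : R) :
  x < e / 4 -> y < e / 4 -> 2 * x + 2 * y < e.
Proof. by lra. Qed.

Section almost_everywhere.
Context d (T : measurableType d) (R : realType) (mu : {measure set T -> \bar R}).
Implicit Types P Q S : T -> Prop.

Lemma ae_imply P Q : (forall z, P z -> Q z) ->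
  {ae mu, forall z, P z} -> {ae mu, forall z, Q z}.
Proof. by move=> PQ; exact: filterS. Qed.

Lemma ae_imply2 P Q S : (forall z, P z -> Q z -> S z) ->
  {ae mu, forall z, P z} -> {ae mu, forall z, Q z} -> {ae mu, forall z, S z}.
Proof. by move=> PQS; exact: filterS2. Qed.

End almost_everywhere.

(** * Transplantation of the form domain and of weak solutions *)

Section transplantation.
Context {R : realType}.
Implicit Types (f u v w : R * R -> R) (g h : R * R -> R * R) (z : R * R).
Local Notation D := (@half_disk R).
Local Notation mu := (area R).

Let mD : measurable (D : set (plane R)) := measurable_half_disk.

(** The weak gradient is obtained from the approximations by [weak_gradient_limit], so only square
    integrability and approximability have to be transplanted. *)
Lemma H1_0P (G : set (R * R)) u g : H1_0 D G u g <->
  L2_pair u g /\ forall e : R, 0 < e -> exists f,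
    [/\ C1_closure D f, (forall z, G z -> f z = 0) &
     energy (fun z => u z - f z) (fun z => g z - grad f z) < e].
Proof.
have LC f : C1_closure D f -> L2_pair f (grad f) by exact: C1_closure_L2.
split=> [[[L0 L1 L2' _] H]|[Lug H]].
  split => // e /H[f [Cf Gf fe]]; exists f; split => //.
  by move: fe; rewrite (integral_energy (L2_pairB (And3 L0 L1 L2') (LC f Cf))) lte_fin.
split.
  have [L0 L1 L2'] := Lug; split => //; apply: weak_gradient_limit => // e /H[f [Cf _ fe]].
  by exists f.
move=> e /H[f [Cf Gf fe]]; exists f; split => //.
by rewrite (integral_energy (L2_pairB Lug (LC f Cf))) lte_fin.
Qed.

Lemma mix_isometry p q r s u v : L2 D u -> L2 D v ->
  p * p + r * r = 1 -> p * q + r * s = 0 -> q * q + s * s = 1 ->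
  \int[mu]_(z in D) (mix p q r s u z * mix p q r s v z) =
  \int[mu]_(z in D) (u z * v z).
Proof.
move=> Lu Lv e1 e2 e3.
have Lm : L2 D (mix p q r s v) by exact: L2_mix.
rewrite mix_adjoint //; apply: eq_Rintegral_ae => //.
- have Lm2 : L2 D (mix p r q s (mix p q r s v)) by exact: L2_mix.
  exact: (measurable_funM Lu.1 Lm2.1).
- exact: (measurable_funM Lu.1 Lv.1).
- apply: ae_off_axis => z Dz Az; rewrite mix_mix //.
  by rewrite [q * p]mulrC [s * r]mulrC.
Qed.

Variables (a k : R).
Hypotheses (ha : a = 1 \/ a = -1) (hk : k * k + k * k = 1).

Lemma transplant_scale : `|k| <= 1.
Proof. by rewrite -ler_sqr ?nnegrE // real_normK ?num_real // expr1n expr2; have := sqr_ge0 k; rewrite expr2; have := hk; lra. Qed.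

Lemma transplant_L2 u : L2 D u -> L2 D (transplant a k u).
Proof. exact: L2_mix. Qed.

Lemma transplant_L2_pair u g : L2_pair u g ->
  L2_pair (transplant a k u) (transplant_grad a k g).
Proof. by move=> [L0 L1 L2']; split; exact: L2_mix. Qed.

Lemma transplant_isometry u v : L2 D u -> L2 D v ->
  \int[mu]_(z in D) (transplant a k u z * transplant a k v z) =
  \int[mu]_(z in D) (u z * v z).
Proof.
by move=> Lu Lv; apply: mix_isometry => //; case: ha => ->; have := hk; nra.
Qed.

Lemma transplant_energy u g : L2_pair u g ->
  energy (transplant a k u) (transplant_grad a k g) = energy u g.
Proof.
move=> [L0 L1 L2']; rewrite /energy transplant_isometry //=.
rewrite mix_isometry //; try by case: ha => ->; have := hk; nra.
rewrite mix_isometry //; try by case: ha => ->; have := hk; nra.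
by rewrite addrAC.
Qed.

Lemma transplantB u v z :
  transplant a k u z - transplant a k v z = transplant a k (fun x => u x - v x) z.
Proof. exact: mixB. Qed.

Lemma transplant_gradB g h z :
  transplant_grad a k g z - transplant_grad a k h z =
  transplant_grad a k (fun x => g x - h x) z.
Proof. by congr pair; rewrite /= mixB. Qed.

(** An approximation of [u] is transplanted isometrically and then smoothed; the two errors of e / 4
    are doubled by [energyD]. The premises isolate the geometry: the ray glued along the cut is
    Dirichlet, and the smoothed function vanishes on the new Dirichlet part. *)
Lemma transplant_H1_0 (G G' : set (R * R)) u g :
  (forall t, 0 < t < 1 -> G (- a * t, 0)) ->
  (forall f w, C1_closure D f -> (forall z, G z -> f z = 0) ->
    (forall x, 0 < a * x -> w (x, 0) = 0) ->
    (forall z, z.1 ^+ 2 + z.2 ^+ 2 = 1 -> 0 < z.2 ->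
      exists c, [/\ 0 <= c, c <= `|z.1|, 1 / 2 <= `|z.1| -> c = `|z.1| &
      (forall t, t = 1 \/ t = -1 -> f (t * Num.sqrt (1 - c ^+ 2), c) = 0) -> w z = 0]) ->
    forall z, G' z -> w z = 0) ->
  H1_0 D G u g -> H1_0 D G' (transplant a k u) (transplant_grad a k g).
Proof.
move=> HG HG' /H1_0P[Lug H]; apply/H1_0P; split; first exact: transplant_L2_pair.
move=> e e0; have e4 : 0 < e / 4 by rewrite divr_gt0.
have [f [Cf Gf fe]] := H _ e4.
have f0 t : 0 < t < 1 -> f (- a * t, 0) = 0 by move=> /HG/Gf.
(* The value 1/2 is below 1/sqrt 2, the abscissa where the two arcs meet, so the outer arc is not
   affected by the flattening. *)
have d0 : (0 : R) < 1 / 2 by lra.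
have [w [Cw w1 w2 we]] := transplant_approx Cf ha transplant_scale f0 e4 d0.
exists w; split => //; first exact: (HG' f w Cf Gf w1 w2).
have Lf : L2_pair f (grad f) := C1_closure_L2 Cf.
have Lw : L2_pair w (grad w) := C1_closure_L2 Cw.
have LTf := transplant_L2_pair Lf.
rewrite (integral_energy (L2_pairB LTf Lw)) lte_fin in we.
have Luf := L2_pairB Lug Lf.
have E1 : (fun z => transplant a k u z - w z) =
  (fun z => transplant a k (fun x => u x - f x) z + (transplant a k f z - w z)).
  by apply/funext => z; rewrite -transplantB addrA subrK.
have E2 : (fun z => transplant_grad a k g z - grad w z) =
  (fun z => transplant_grad a k (fun x => g x - grad f x) z +
            (transplant_grad a k (grad f) z - grad w z)).
  by apply/funext => z; rewrite -transplant_gradB addrA subrK.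
rewrite E1 E2; apply: le_lt_trans (energyD (transplant_L2_pair Luf) (L2_pairB LTf Lw)) _.
rewrite (transplant_energy Luf).
exact: (ltr_double_quarter fe we).
Qed.

Lemma transplantK u z : D z -> ~ axis z ->
  transplant a k (transplant (- a) k u) z = u z.
Proof.
by move=> Dz Az; apply: mix_mix => //; case: ha => ->; have := hk; nra.
Qed.

Lemma transplant_adjoint u v : L2 D u -> L2 D v ->
  \int[mu]_(z in D) (transplant a k u z * v z) =
  \int[mu]_(z in D) (u z * transplant (- a) k v z).
Proof. by move=> Lu Lv; rewrite /transplant mix_adjoint // opprK. Qed.

Lemma transplant_grad_adjoint g h (u v : R * R -> R) : L2_pair u g -> L2_pair v h ->
  \int[mu]_(z in D) dot (transplant_grad a k g z) (h z) =
  \int[mu]_(z in D) dot (g z) (transplant_grad (- a) k h z).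
Proof.
move=> [_ g1 g2] [_ h1 h2]; rewrite /dot /transplant_grad /=.
have m p q r s w : L2 D w -> L2 D (mix p q r s w) by exact: L2_mix.
rewrite RintegralD //; last 2 first.
- exact: (sqintM mD (m _ _ _ _ _ g2) h1).
- exact: (sqintM mD (m _ _ _ _ _ g1) h2).
rewrite RintegralD //; last 2 first.
- exact: (sqintM mD g1 (m _ _ _ _ _ h2)).
- exact: (sqintM mD g2 (m _ _ _ _ _ h1)).
by rewrite mix_adjoint // mix_adjoint // addrC opprK.
Qed.

(** The values at one point involve two others, so null sets are handled through the isometry: the
    transplant of a difference of norm 0 has norm 0. *)
Lemma transplant_ae u v : L2 D u -> L2 D v -> ae_equal D u v ->
  ae_equal D (transplant a k u) (transplant a k v).
Proof.
move=> Lu Lv uv; have Luv := sqintB mD Lu Lv.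
have I0 : \int[mu]_(z in D) ((u z - v z) * (u z - v z)) = 0.
  transitivity (\int[mu]_(z in D) (cst (0 : R) z)); last first.
    by rewrite Rintegral_cst // mul0r.
  apply: eq_Rintegral_ae => //; first exact: (measurable_funM Luv.1 Luv.1).
  by apply: (ae_imply _ uv) => z H Dz; rewrite H // subrr mul0r.
have J0 := transplant_isometry Luv Luv; rewrite I0 in J0.
have := sqint_ae0 mD (transplant_L2 Luv) J0.
apply: ae_imply => z H Dz; apply/eqP; rewrite -subr_eq0; apply/eqP.
by rewrite transplantB; exact: H.
Qed.

Lemma weak_solution_L2 (G : set (R * R)) l f u : weak_solution D G l f u -> L2 D u.
Proof. by case=> g [[[] ]]. Qed.

(** Test functions are carried back by the adjoint, which is the opposite transplantation and maps
    one form domain into the other. *)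
Lemma transplant_weak_solution (G G' : set (R * R)) l f u :
  (forall w h, H1_0 D G w h -> H1_0 D G' (transplant a k w) (transplant_grad a k h)) ->
  (forall w h, H1_0 D G' w h -> H1_0 D G (transplant (- a) k w) (transplant_grad (- a) k h)) ->
  L2 D f -> weak_solution D G l f u ->
  weak_solution D G' l (transplant a k f) (transplant a k u).
Proof.
move=> TG TG' Lf [g [Hug H]]; exists (transplant_grad a k g).
split; first exact: TG.
move=> w h Hwh; have /H1_0P[Lug _] := Hug; have /H1_0P[Lwh _] := Hwh.
have [Lu _ _] := Lug; have [Lw _ _] := Lwh.
rewrite (transplant_grad_adjoint Lug Lwh) (transplant_adjoint Lu Lw).
rewrite (transplant_adjoint Lf Lw).
exact: (H _ _ (TG' _ _ Hwh)).
Qed.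

(** Used because opposite transplantations are inverse only off the axis, hence only almost
    everywhere. *)
Lemma eq_weak_solution (G : set (R * R)) l f f' u : L2 D f -> L2 D f' ->
  ae_equal D f f' -> weak_solution D G l f u -> weak_solution D G l f' u.
Proof.
move=> Lf Lf' ff' [g [Hug H]]; exists g; split => // w h Hwh; rewrite H //.
have /H1_0P[[Lw _ _] _] := Hwh.
apply: eq_Rintegral_ae => //.
- exact: (measurable_funM Lf.1 Lw.1).
- exact: (measurable_funM Lf'.1 Lw.1).
- by apply: (ae_imply _ ff') => z E Dz; rewrite E.
Qed.

End transplantation.

(** * Transfer of the resolvent set and of eigenspaces *)

Section isospectrality.
Context {R : realType}.
Implicit Types (f u v w : R * R -> R) (g h : R * R -> R * R) (z : R * R).
Local Notation D := (@half_disk R).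
Local Notation mu := (area R).
Let mD : measurable (D : set (plane R)) := measurable_half_disk.

Variables (a k l : R) (G G' : set (R * R)).
Hypotheses (ha : a = 1 \/ a = -1) (hk : k * k + k * k = 1).
Hypothesis TG : forall w h, H1_0 D G w h ->
  H1_0 D G' (transplant a k w) (transplant_grad a k h).
Hypothesis TG' : forall w h, H1_0 D G' w h ->
  H1_0 D G (transplant (- a) k w) (transplant_grad (- a) k h).

Let ha' : - a = 1 \/ - a = -1.
Proof. by case: ha => ->; [right | left]; rewrite ?opprK. Qed.

Lemma transplantVK u z : D z -> ~ axis z ->
  transplant (- a) k (transplant a k u) z = u z.
Proof. by move=> Dz Az; have := transplantK ha' hk u Dz Az; rewrite opprK. Qed.

(** The equation is solved for the right-hand side carried back, and the solution is transplanted; a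
    competing solution is carried back and compared there. *)
Lemma transplant_resolvent :
  (forall f, L2 D f -> exists u, weak_solution D G l f u /\
     forall v, weak_solution D G l f v -> ae_equal D u v) ->
  forall f, L2 D f -> exists u, weak_solution D G' l f u /\
     forall v, weak_solution D G' l f v -> ae_equal D u v.
Proof.
move=> H f Lf; have Lf' := transplant_L2 (- a) k Lf.
have [u [Su uniq_u]] := H _ Lf'; have Lu := weak_solution_L2 Su.
exists (transplant a k u); split.
  apply: (eq_weak_solution (transplant_L2 a k Lf') Lf).
    by apply: ae_off_axis => z Dz Az; exact: transplantK.
  exact: transplant_weak_solution TG TG' Lf' Su.
move=> v Sv; have Lv := weak_solution_L2 Sv.
have TGo w h : H1_0 D G w h -> H1_0 D G' (transplant (- - a) k w) (transplant_grad (- - a) k h).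
  by rewrite opprK; exact: TG.
have /uniq_u uv := transplant_weak_solution TG' TGo Lf Sv.
have Lv' := transplant_L2 (- a) k Lv.
have := transplant_ae ha hk Lu Lv' uv.
have : ae_equal D (transplant a k (transplant (- a) k v)) v.
  by apply: ae_off_axis => z Dz Az; exact: transplantK.
move=> K S; apply: (ae_imply2 _ K S) => z E1 E2 Dz; by rewrite E2 // E1.
Qed.

Lemma transplant_sum n (c : 'I_n -> R) (u : 'I_n -> R * R -> R) z :
  \sum_(i < n) c i * transplant a k (u i) z =
  transplant a k (fun x => \sum_(i < n) c i * u i x) z.
Proof.
rewrite /transplant /mix; case: ifP => _; last case: ifP => _.
- by rewrite !mulr_sumr -big_split; apply: eq_bigr => i _ /=; ring.
- by rewrite !mulr_sumr -big_split; apply: eq_bigr => i _ /=; ring.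
- by rewrite big1 // => i _; rewrite mulr0.
Qed.

Lemma L2_0 : L2 D (cst 0).
Proof. exact: (sqint0 (area R) (D : set (plane R))). Qed.

Lemma L2_sum n (c : 'I_n -> R) (u : 'I_n -> R * R -> R) :
  (forall i, L2 D (u i)) -> L2 D (fun x => \sum_(i < n) c i * u i x).
Proof.
elim: n c u => [|n IH] c u Lu.
  by apply: (eq_sqint mD _ L2_0) => z _; rewrite big_ord0.
apply: (eq_sqint mD _ (sqintD mD (sqintZ mD (c ord0) (Lu ord0))
  (IH (fun i => c (lift ord0 i)) (fun i => u (lift ord0 i)) (fun i => Lu _)))).
by move=> z _; rewrite big_ord_recl.
Qed.

Lemma transplant0 : transplant a k (cst 0) = cst 0.
Proof. by apply/funext => z; rewrite /transplant /mix /= !mulr0 !addr0 !if_same. Qed.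

(** A linear relation between the transplants becomes, under the opposite transplantation, the same
    relation between the original functions. *)
Lemma transplant_eigenfunctions n :
  (exists u : 'I_n -> (R * R -> R), (forall i, weak_eigenspace D G l (u i)) /\
     forall c : 'I_n -> R,
       ae_equal D (fun z => \sum_(i < n) c i * u i z) (cst 0) -> forall i, c i = 0) ->
  (exists u : 'I_n -> (R * R -> R), (forall i, weak_eigenspace D G' l (u i)) /\
     forall c : 'I_n -> R,
       ae_equal D (fun z => \sum_(i < n) c i * u i z) (cst 0) -> forall i, c i = 0).
Proof.
move=> [u [Eu free_u]]; exists (fun i => transplant a k (u i)); split.
  move=> i; have := transplant_weak_solution TG TG' L2_0 (Eu i).
  by rewrite transplant0.
have Lu i : L2 D (u i) := weak_solution_L2 (Eu i).
move=> c c0; apply: free_u; have Ls := L2_sum c Lu.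
have TE : (fun z => \sum_(i < n) c i * transplant a k (u i) z) =
    transplant a k (fun x => \sum_(i < n) c i * u i x).
  by apply/funext => z; exact: transplant_sum.
rewrite TE in c0.
have := transplant_ae ha' hk (transplant_L2 a k Ls) L2_0 c0.
have K : ae_equal D (transplant (- a) k (transplant a k (fun x => \sum_(i < n) c i * u i x)))
   (fun x => \sum_(i < n) c i * u i x).
  by apply: ae_off_axis => z Dz Az; exact: transplantVK.
move=> S; apply: (ae_imply2 _ K S) => z E1 E2 Dz; rewrite -E1 // E2 //.
by rewrite /transplant /mix /= !mulr0 !addr0 !if_same.
Qed.

End isospectrality.

(** * The Dirichlet conditions of the two problems *)

Section mixed_boundary.
Context {R : realType}.
Implicit Types (f w : R * R -> R) (z : R * R).
Local Notation D := (@half_disk R).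

(** The corners belong to neither boundary set, yet the flattening leads there from points of the
    middle arc with c = 0. The value is obtained by continuity along the arc. *)
Lemma vanishing_corner f t : C1_closure D f -> t = 1 \/ t = -1 ->
  (forall d, 0 < d < 1 / 2 -> f (t * Num.sqrt (1 - d ^+ 2), d) = 0) ->
  f (t, 0) = 0.
Proof.
move=> [U [_ clU fC1]] ht f0.
have tcl : closure D (t, 0).
  by apply/closure_half_diskP; split => //=; case: ht => ->; rewrite ?sqrrN !expr1n expr0n addr0.
have [df _] := fC1 _ (clU _ tcl).
pose p (d : R) : R * R := (t * Num.sqrt (1 - d ^+ 2), d).
have p0 : p 0 = (t, 0) by rewrite /p expr0n subr0 sqrtr1 mulr1.
have cs : {for 0, continuous (fun d : R => t * Num.sqrt (1 - d ^+ 2))}.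
  apply: cvgM; first exact: cvg_cst.
  apply: (@continuous_comp _ _ _ (fun d : R => 1 - d ^+ 2) Num.sqrt); last exact: sqrt_continuous.
  by apply: cvgB; [exact: cvg_cst | exact: exprn_continuous].
have cp : {for 0, continuous p} by exact: (cvg_pair cs cvg_id).
have cfp : {for 0, continuous (f \o p)}.
  by apply: continuous_comp => //; rewrite p0; exact: differentiable_continuous.
have c1 : (f \o p) x @[x --> 0^'+] --> f (t, 0).
  by rewrite -p0; apply: cvg_at_right_filter; exact: cfp.
have c2 : (f \o p) x @[x --> 0^'+] --> (0 : R).
  apply: (@cvg_trans _ ((cst (0 : R)) x @[x --> (0 : R)^'+])); last exact: cvg_cst.
  apply: near_eq_cvg; near=> d; rewrite /= f0 //; apply/andP; split.
    by near: d; exact: nbhs_right_gt.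
  by near: d; apply: nbhs_right_lt; lra.
exact: (cvg_unique _ c1 c2).
Unshelve. all: by end_near. Qed.

(** A point of the outer arc has |x| > 1/sqrt 2, so c = |x|, and the exchange of coordinates gives
    points of the middle arc. *)
Lemma transplant_boundary1 (k : R) u g : k * k + k * k = 1 ->
  H1_0 D (@boundary1 R) u g ->
  H1_0 D (@boundary2 R) (transplant 1 k u) (transplant_grad 1 k g).
Proof.
move=> hk; apply: transplant_H1_0 => //; first by left.
  by move=> t t01; left; split => //=; rewrite mulN1r; lra.
move=> f w Cf Gf waxis warc [x y] [[/= x01 ->]|/outer_arcP[e1 y0 yx]].
  by apply: waxis; rewrite mul1r; lra.
have [c [c0 cx cE ->//]] := warc (x, y) e1 y0.
move=> t ht; rewrite cE; last first.
  by rewrite -ler_sqr ?nnegrE //= real_normK ?num_real //; move: e1 yx; nra.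
apply: Gf; right; apply/middle_arcP.
have tt : t ^+ 2 = 1 by case: ht => ->; rewrite ?sqrrN expr1n.
have E : 1 - `|x| ^+ 2 = y ^+ 2 by rewrite real_normK ?num_real //; rewrite -e1 /=; ring.
rewrite /= exprMn tt mul1r E sqrtr_sqr real_normK ?num_real // real_normK ?num_real //.
split => //; first by rewrite addrC.
by rewrite normr_gt0; apply/eqP => x0; move: yx; rewrite x0 expr0n /= ltNge sqr_ge0.
Qed.

(** The middle arc crosses the flattened strip. Since c <= |x|, still c^2 < 1/2, so the evaluation
    points stay on the outer arc, or are corners if c = 0. *)
Lemma transplant_boundary2 (k : R) u g : k * k + k * k = 1 ->
  H1_0 D (@boundary2 R) u g ->
  H1_0 D (@boundary1 R) (transplant (-1) k u) (transplant_grad (-1) k g).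
Proof.
move=> hk; apply: transplant_H1_0 => //; first by right.
  by move=> t t01; left; split => //=; rewrite opprK mul1r.
move=> f w Cf Gf waxis warc [x y] [[/= x01 ->]|/middle_arcP[e1 y0 xy]].
  by apply: waxis; rewrite mulN1r; lra.
have [c [c0 cx cE ->//]] := warc (x, y) e1 y0.
have outer d t : t = 1 \/ t = -1 -> 0 < d -> d ^+ 2 < 1 / 2 ->
    f (t * Num.sqrt (1 - d ^+ 2), d) = 0.
  move=> ht d0 d2; apply: Gf; right; apply/outer_arcP.
  have tt : t ^+ 2 = 1 by case: ht => ->; rewrite ?sqrrN expr1n.
  rewrite exprMn tt mul1r sqr_sqrtr; last by lra.
  by split => //; lra.
move=> t ht; have [c00|c00] := ltP 0 c.
  apply: outer => //.
  have : c ^+ 2 <= `|x| ^+ 2 by rewrite lerXn2r ?nnegrE.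
  by rewrite real_normK ?num_real //; move: e1 xy => /=; lra.
have -> : c = 0 by apply/eqP; rewrite eq_le c00.
rewrite expr0n subr0 sqrtr1 mulr1; apply: vanishing_corner => // d /andP[d0 d1].
apply: outer => //; nra.
Qed.

End mixed_boundary.

Theorem theorem2p1p3 (R : realType) :
  spectrum (@half_disk R) (@boundary1 R) = spectrum (@half_disk R) (@boundary2 R)
  /\ forall l : R,
       multiplicity (@half_disk R) (@boundary1 R) l
         = multiplicity (@half_disk R) (@boundary2 R) l.
Proof.
pose k : R := (Num.sqrt 2)^-1.
have hk : k * k + k * k = 1.
  by rewrite -invfM -expr2 sqr_sqrtr //; field.
have h1 : (1 : R) = 1 \/ (1 : R) = -1 by left.
have h2 : (-1 : R) = 1 \/ (-1 : R) = -1 by right.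
have T1 u g := @transplant_boundary1 R k u g hk.
have T2 u g := @transplant_boundary2 R k u g hk.
have T1' u g : H1_0 (@half_disk R) (@boundary1 R) u g ->
  H1_0 (@half_disk R) (@boundary2 R) (transplant (- -1) k u) (transplant_grad (- -1) k g).
  by rewrite opprK; exact: T1.
split.
  (* Spectra are complements of resolvent sets, so each inclusion uses the transplantation in the
     reverse direction. *)
  apply/seteqP; split => l /= H K; apply: H.
    exact: (transplant_resolvent h2 hk T2 T1' K).
  exact: (transplant_resolvent h1 hk T1 T2 K).
move=> l; rewrite /multiplicity; congr (ereal_sup [set _ | _ in _]).
apply/seteqP; split => n /= H.
  exact: (transplant_eigenfunctions h1 hk T1 T2 H).
exact: (transplant_eigenfunctions h2 hk T2 T1' H).
Qed.
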